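(* Let $k$ be even. A matching of size $k$ belongs to a connected component of $\mathbf{DCM}_k$ with exactly two vertices if and only if it is a DB-matching.
   Context: Let $k\ge 1$ and let $X_{2k}=\{P_1,\dots,P_{2k}\}$ be $2k$ points in convex position in the plane, labeled in clockwise cyclic order. A matching of $X_{2k}$ means a set of $k$ pairwise non-crossing straight segments (edges) with endpoints in $X_{2k}$ covering every point exactly once; its size is $k$. Two matchings $M,M'$ of $X_{2k}$ are disjoint compatible if they have no common edge and no edge of $M$ crosses an edge of $M'$. $\mathbf{DCM}_k$ is the graph whose vertices are the matchings of $X_{2k}$, two being adjacent iff they are disjoint compatible. Dual tree: place the points on a circle and regard the edges of a matching $M$ as pairwise disjoint chords; they cut the disk into $k+1$ regions. The dual tree $D(M)$ is the (abstract) tree whose vertices are these regions, two regions being adjacent iff their boundaries share a chord of $M$. For even $k=2\ell$, a DB-matching is a matching $M$ whose dual tree is isomorphic (as an abstract graph) to the tree with vertices $B_0,\dots,B_\ell,D_1,\dots,D_\ell$ and edges $B_0D_1$, $D_iD_{i+1}$ ($1\le i\le \ell-1$), and $D_iB_i$ ($1\le i\le \ell$). *)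

(* Defs.v *)
From mathcomp Require Import all_boot.
Set Implicit Arguments. Unset Strict Implicit. Unset Printing Implicit Defensive.

(* Points P_1..P_{2k} in convex (clockwise) position are modelled by 'I_(k.*2),
   point P_{i+1} <-> ordinal i.  Crossing of segments between points in convex
   position is purely combinatorial: two segments with four distinct endpoints
   cross iff their endpoints interleave in the cyclic order. *)

Definition strictly_between (x a b : nat) : bool := (minn a b < x < maxn a b)%N.

Definition cross (a b c d : nat) : bool :=
  [&& a != c, a != d, b != c, b != d &
      strictly_between c a b != strictly_between d a b].

Definition is_matching (n : nat) (f : {ffun 'I_n -> 'I_n}) : bool :=
  [forall i : 'I_n, (f (f i) == i) && (f i != i)] &&
  [forall i : 'I_n, forall j : 'I_n, ~~ cross i (f i) j (f j)].

Definition matching (k : nat) : finType :=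
  {f : {ffun 'I_(k.*2) -> 'I_(k.*2)} | is_matching f}.

Definition dcm_adj (k : nat) (M N : matching k) : bool :=
  [forall i : 'I_(k.*2), val M i != val N i] &&
  [forall i : 'I_(k.*2), forall j : 'I_(k.*2), ~~ cross i (val M i) j (val N j)].

Definition dcm_component (k : nat) (M : matching k) : {set matching k} :=
  [set N | connect (@dcm_adj k) M N].

(* Dual tree.  The boundary circle is cut by the 2k points into 2k arcs; arc i
   runs from point i to point i+1 (mod 2k).  Since the chords have pairwise
   distinct endpoints, every region of the disk contains at least one arc, and
   two arcs lie in the same region iff no chord separates them.  Two regions
   are adjacent (share a chord) iff they contain arcs separated by exactly one
   chord.  Chord {a,b} separates arcs i, j iff exactly one of them lies on the
   side min(a,b) <= . < max(a,b). *)
Definition arc_inside (a b i : nat) : bool := (minn a b <= i < maxn a b)%N.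

Definition nsep (n : nat) (f : {ffun 'I_n -> 'I_n}) (i j : 'I_n) : nat :=
  #|[set p : 'I_n | (p < f p)%N &&
       (arc_inside p (f p) i != arc_inside p (f p) j)]|.

(* The tree for k = 2l: vertices B_0..B_l (inl b, b : 'I_(l+1), b <-> B_b) and
   D_1..D_l (inr d, d : 'I_l, d <-> D_(d+1)); edges B_0D_1, D_iD_(i+1), D_iB_i. *)
Definition db_vertex (l : nat) : finType := ('I_l.+1 + 'I_l)%type.

Definition db_edge0 (l : nat) (u v : db_vertex l) : bool :=
  match u, v with
  | inl b, inr d => (val b == 0) && (val d == 0)
  | inr d, inr d' => val d' == (val d).+1
  | inr d, inl b => val b == (val d).+1
  | _, _ => false
  end.

Definition db_adj (l : nat) (u v : db_vertex l) : bool :=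
  db_edge0 u v || db_edge0 v u.

(* M is a DB-matching (k = 2l): its dual tree is isomorphic to the DB tree,
   i.e. there is a map phi from arcs onto tree vertices whose fibres are
   exactly the regions and which maps region adjacency onto tree adjacency. *)
Definition is_DB (k : nat) (M : matching k) : Prop :=
  exists phi : 'I_(k.*2) -> db_vertex k./2,
    (forall u, exists i, phi i = u) /\
    (forall i j, phi i = phi j <-> nsep (val M) i j = 0) /\
    (forall u v, db_adj u v <->
       exists i j, [/\ phi i = u, phi j = v & nsep (val M) i j = 1]).

(* Main.v *)
(** Let [f] and [g] be disjoint compatible matchings which are each other's only
    neighbours.  Replacing two edges [ab], [cd] of [f] by [ad], [bc] whenever the
    new edges meet neither [f] nor [g] (a flip) would give a further neighbour of
    [g], so every such sequence of flips must create an edge of [g].  Applied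
    below an edge of [f] whose strict inside is stable under [g], this forces the
    inside to start with a quadrilateral [L, f L, f R, R] alternating between
    [f] and [g], with [L] and [R] the extreme points, at most one of whose gaps
    contains points; by induction [f] and [g] are obtained from the empty
    matching by the steps
      [f := ()(f), g := (()g)]    or    [f := (f)(), g := (g())]    (chains).
    After a rotation the whole pair is a chain.  Conversely the neighbours of
    both members of a chain are forced edge by edge.  Finally the dual tree of
    the first member of a chain grows by [D_m] and its leaf [B_m] at every step,
    so it is the DB tree; and in a matching whose dual tree is the DB tree, the
    arcs met along the circle form an Euler tour of the tree, in which the chain
    is read off from [D_l] downwards. *)

Require Import Defs.
From mathcomp Require Import all_boot.
From mathcomp Require Import zify.
Set Implicit Arguments. Unset Strict Implicit. Unset Printing Implicit Defensive.

(** * Cyclic shifts and the crossing relation *)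

Definition tau n r x := if x + r < n then x + r else x + r - n.

(** The shift [r = n] is allowed throughout, so that [n - r] inverts [r] even for [r = 0]. *)
Lemma tau_lt n r x : r <= n -> x < n -> tau n r x < n.
Proof. by rewrite /tau; case: ifP => ?; lia. Qed.

Lemma tauK n r x : r <= n -> x < n -> tau n (n - r) (tau n r x) = x.
Proof. by rewrite /tau => ? ?; case: (ltnP (x + r) n) => ?; case: ltnP; lia. Qed.

Lemma tauKV n r x : r <= n -> x < n -> tau n r (tau n (n - r) x) = x.
Proof. by rewrite /tau => ? ?; case: (ltnP (x + (n - r)) n) => ?; case: ltnP; lia. Qed.

Lemma tau_inj n r x y : r <= n -> x < n -> y < n ->
  (tau n r x == tau n r y) = (x == y).
Proof.
move=> hr hx hy; apply/eqP/eqP => [e|-> //].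
by rewrite -(tauK hr hx) -(tauK hr hy) e.
Qed.

(** A shift cuts the circle at another place. When exactly one of [a], [b] passes the cut, the two
    sides of the chord trade places; this is the correction term. *)
Lemma strictly_between_tau n r x a b : r <= n -> x < n -> a < n -> b < n ->
  x != a -> x != b ->
  strictly_between (tau n r x) (tau n r a) (tau n r b) =
  strictly_between x a b (+) ((a + r < n) != (b + r < n)).
Proof.
move=> hr hx ha hb; rewrite /strictly_between /tau.
by case: (ltnP (x + r) n); case: (ltnP (a + r) n); case: (ltnP (b + r) n);
  rewrite ?eqxx ?addbF ?addbT; lia.
Qed.

Lemma cross_tau n r a b c d : r <= n -> a < n -> b < n -> c < n -> d < n ->
  cross (tau n r a) (tau n r b) (tau n r c) (tau n r d) = cross a b c d.
Proof.
move=> hr ha hb hc hd; rewrite /cross !tau_inj //.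
case: eqP => //= /eqP n1; case: eqP => //= /eqP n2; case: eqP => //= /eqP n3.
case: eqP => //= /eqP n4.
rewrite !(strictly_between_tau hr) //; try by rewrite eq_sym.
(* The correction depends on [a] and [b] only, so it cancels when the sides of [c] and [d] are
   compared. *)
by case: ((a + r < n) != (b + r < n)); case: strictly_between; case: strictly_between.
Qed.

Lemma arc_inside_tau n r a b x : r <= n -> a < n -> b < n -> x < n ->
  arc_inside (tau n r a) (tau n r b) (tau n r x) =
  arc_inside a b x (+) ((a + r < n) != (b + r < n)).
Proof.
move=> hr ha hb hx; rewrite /arc_inside /tau.
by case: (ltnP (x + r) n); case: (ltnP (a + r) n); case: (ltnP (b + r) n);
  rewrite ?eqxx ?addbF ?addbT; lia.
Qed.

Lemma crossC a b c d : cross a b c d = cross c d a b.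
Proof. rewrite /cross /strictly_between; lia. Qed.

Lemma cross_swapl a b c d : cross a b c d = cross b a c d.
Proof. by rewrite /cross /strictly_between minnC maxnC; lia. Qed.

Lemma cross_swapr a b c d : cross a b c d = cross a b d c.
Proof. by rewrite crossC cross_swapl crossC. Qed.

Lemma ncross_in a b x y : a < b -> ~~ cross a b x y -> a < x < b -> a <= y <= b.
Proof. rewrite /cross /strictly_between; lia. Qed.

Lemma ncrossI a b x y : a < b ->
  (a < x < b -> a <= y <= b) -> (a < y < b -> a <= x <= b) -> ~~ cross a b x y.
Proof. rewrite /cross /strictly_between => *; apply/negP; lia. Qed.

(** * Matchings as functions on natural numbers, and flips *)
Definition preserves (f : nat -> nat) a b := forall x, a <= x < b -> a <= f x < b.

(** The domain is open and the target closed because an edge may share an endpoint with the chord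
    [ab] without crossing it. *)
Definition fenced (f : nat -> nat) a b := forall x, a < x < b -> a <= f x <= b.

Definition pairing n (f : nat -> nat) :=
  forall x, x < n -> [/\ f x < n, f (f x) = x & f x <> x].

Definition compatible n (f g : nat -> nat) :=
  forall x y, x < n -> y < n -> ~~ cross x (f x) y (g y).

Definition ncm n f := pairing n f /\ compatible n f f.

Definition edge_disjoint n (f g : nat -> nat) := forall x, x < n -> f x <> g x.

Definition sole_neighbour n f g :=
  forall h, ncm n h -> compatible n f h -> edge_disjoint n f h ->
  forall x, x < n -> h x = g x.

Record isolated_pair n f g : Prop := IsolatedPair {
  pair_ncml : ncm n f;
  pair_ncmr : ncm n g;
  pair_compatible : compatible n f g;
  pair_disjoint : edge_disjoint n f g;
  pair_solel : sole_neighbour n f g;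
  pair_soler : sole_neighbour n g f }.

Lemma compatibleC n f g : compatible n f g -> compatible n g f.
Proof. by move=> c x y hx hy; rewrite crossC c. Qed.

Lemma edge_disjointC n f g : edge_disjoint n f g -> edge_disjoint n g f.
Proof. by move=> d x hx e; apply: (d x hx). Qed.

Lemma isolated_pairC n f g : isolated_pair n f g -> isolated_pair n g f.
Proof.
by case=> *; split=> //; [exact: compatibleC | exact: edge_disjointC].
Qed.

Lemma fenced_chord n f g a : compatible n f g -> a < f a -> f a < n ->
  fenced g a (f a).
Proof.
move=> c hl hn x hx; have hxn : x < n by lia.
by apply: ncross_in (c a x _ hxn) hx; lia.
Qed.

Lemma fencedP n e a b : pairing n e -> a < b -> b < n -> fenced e a b ->
  forall x, x < n -> ~~ cross a b x (e x).
Proof.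
move=> pe hab hb fe x hx; apply: ncrossI => // h; first exact: fe.
by have [_ <- _] := pe x hx; apply: fe.
Qed.

(** The edge at [a] uses up two points and leaves its inside and the part after [f a]; both are
    stable and shorter. *)
Lemma closed_even n f : ncm n f -> forall a b, b <= n -> preserves f a b ->
  ~~ odd (b - a).
Proof.
case=> pf cf a b; have [m] := ubnP (b - a).
elim: m a b => // m IH a b hm hb hc.
have [hab|hab] := leqP b a; first by rewrite (_ : b - a = 0) //; lia.
have [f1 f2 f3] := pf a ltac:(lia).
have := hc a ltac:(lia) => fa.
have fen : fenced f a (f a) by apply: fenced_chord cf _ _; lia.
have c1 : preserves f a.+1 (f a).
  move=> x hx; have := fen x ltac:(lia); have [_ e ne] := pf x ltac:(lia).
  case: (eqVneq (f x) a) => [ex|]; first by rewrite ex in e; lia.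
  case: (eqVneq (f x) (f a)) => [ex|]; last lia.
  by rewrite ex f2 in e; lia.
have c2 : preserves f (f a).+1 b.
  move=> x hx; have hfx := hc x ltac:(lia); have [_ e ne] := pf x ltac:(lia).
  case: (eqVneq (f x) a) => [ex|n1]; first by rewrite ex in e; lia.
  case: (eqVneq (f x) (f a)) => [ex|n2]; first by rewrite ex f2 in e; lia.
  case: (leqP (f x) (f a)) => [hle|]; last lia.
  by have := fen (f x) ltac:(lia); rewrite e; lia.
by have := IH (f a).+1 b ltac:(lia) hb c2;
   have := IH a.+1 (f a) ltac:(lia) ltac:(lia) c1; lia.
Qed.

(* Otherwise [a, f a) would be closed under g while (a, f a) is closed under f,
   and both lengths would be even. *)
Lemma same_side n f g a b : ncm n f -> ncm n g -> compatible n f g ->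
  a < b -> b < n -> f a = b ->
  (a < g a < b -> a < g b < b) /\ (a < g b < b -> a < g a < b).
Proof.
move=> nf ng c hab hb fab.
have [pf cf] := nf; have [pg cg] := ng.
have [_ fba _] := pf a ltac:(lia); rewrite fab in fba.
have fenf : fenced f a b by rewrite -fab; apply: fenced_chord cf _ _; lia.
have feng : fenced g a b by rewrite -fab; apply: fenced_chord c _ _; lia.
have ev : ~~ odd (b - a.+1).
  apply: (closed_even nf) => [|x hx]; first lia.
  have := fenf x ltac:(lia); have [_ e ne] := pf x ltac:(lia).
  by case: (eqVneq (f x) a) => [ex|]; case: (eqVneq (f x) b) => [ey|];
    rewrite ?ex ?ey in e; lia.
have [ga1 ga2 ga3] := pg a ltac:(lia); have [gb1 gb2 gb3] := pg b hb.
split=> h; case: (boolP (a < _ < b)) => // hn.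
- have : ~~ odd (b - a); last lia.
  apply: (closed_even ng) => [|x hx]; first lia.
  case: (eqVneq x a) => [->|nx]; first lia.
  have := feng x ltac:(lia); have [_ e ne] := pg x ltac:(lia).
  by case: (eqVneq (g x) b) => [ey|]; rewrite ?ey in e; lia.
- have : ~~ odd (b.+1 - a.+1); last lia.
  apply: (closed_even ng) => [|x hx]; first lia.
  case: (eqVneq x b) => [->|nx]; first lia.
  have := feng x ltac:(lia); have [_ e ne] := pg x ltac:(lia).
  by case: (eqVneq (g x) a) => [ey|]; rewrite ?ey in e; lia.
Qed.

Definition uncrossed n (e : nat -> nat) a b :=
  forall x, x < n -> ~~ cross a b x (e x).

Lemma uncrossedC n e a b : uncrossed n e a b -> uncrossed n e b a.
Proof. by move=> u x hx; rewrite cross_swapl u. Qed.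

Definition flip (f : nat -> nat) a b c d x :=
  if x == a then d else if x == d then a else
  if x == b then c else if x == c then b else f x.

Lemma flip_uncrossed n f a b c d u v : uncrossed n f u v ->
  ~~ cross u v a d -> ~~ cross u v b c -> uncrossed n (flip f a b c d) u v.
Proof.
move=> h h1 h2 x hx; rewrite /flip.
case: eqP => [->|_] //; case: eqP => [->|_]; first by rewrite cross_swapr.
case: eqP => [->|_] //; case: eqP => [->|_]; first by rewrite cross_swapr.
exact: h.
Qed.

Lemma flip_chord n f a b c d (P : nat -> nat -> Prop) :
  (forall x y, P x y -> P y x) -> P a d -> P b c ->
  (forall x, x < n -> P x (f x)) -> forall x, x < n -> P x (flip f a b c d x).
Proof.
move=> sP ad bc h x hx; rewrite /flip.
case: eqP => [->|_] //; case: eqP => [->|_]; first exact: sP.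
case: eqP => [->|_] //; case: eqP => [->|_]; first exact: sP.
exact: h.
Qed.

Lemma flip_compatible n f g a b c d : compatible n f g ->
  uncrossed n g a d -> uncrossed n g b c -> compatible n (flip f a b c d) g.
Proof.
move=> c0 h1 h2 x y hx; move: y.
by apply: (flip_chord (P := uncrossed n g)) hx => // [u v|u hu y];
  [exact: uncrossedC | exact: c0].
Qed.

Lemma flip_ncm n f a b c d : ncm n f -> f a = b -> f c = d -> a <> c -> a <> d ->
  [/\ a < n, b < n, c < n & d < n] ->
  uncrossed n f a d -> uncrossed n f b c -> ~~ cross a d b c ->
  ncm n (flip f a b c d).
Proof.
move=> [pf cf] fab fcd nac nad [ha hb hc hd] had hbc hx.
have [_ fba nab] := pf a ha; have [_ fdc ncd] := pf c hc.
rewrite fab in fba nab; rewrite fcd in fdc ncd.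
have nbd : b <> d by move=> e; rewrite e in fba; lia.
have nbc : b <> c by move=> e; rewrite e fcd in fba; lia.
have s x y : ~~ cross x y x y by rewrite /cross eqxx.
split=> [x hxn|].
  rewrite /flip; have [fx ffx nx] := pf x hxn.
  do 4 (case: eqP => [?|?]; first by subst; split=> //; do ?case: eqP; lia).
  by split=> //; do 4 (case: eqP => [ex|?]; first by rewrite ex in ffx; lia).
apply: flip_compatible; last 2 first.
- by apply: flip_uncrossed.
- by apply: flip_uncrossed => //; rewrite crossC.
apply: compatibleC; apply: flip_compatible => //; exact: compatibleC.
Qed.

(** This is how flips are exploited: [h] is a neighbour of [g], hence equal to [f], so a single
    point where they differ is a contradiction. *)
Lemma isolated_pair_no_other n f g h x : isolated_pair n f g ->
  ncm n h -> compatible n h g -> edge_disjoint n h g -> x < n -> h x <> f x -> False.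
Proof.
move=> U nh ch dh hx; apply; apply: (pair_soler U) => //.
  exact: compatibleC.
exact: edge_disjointC.
Qed.

(** The edges [ab], [cd], side by side, become the nested edges [ad], [bc]. For [f] only the middle
    gap needs a fence, since its own edges fence what lies below them. *)
Lemma flip_nest n f g a b c d : ncm n g -> ncm n f -> compatible n f g ->
  a < b -> b < c -> c < d -> d < n -> f a = b -> f c = d ->
  fenced g a d -> fenced f b c -> fenced g b c ->
  ncm n (flip f a b c d) /\ compatible n (flip f a b c d) g.
Proof.
move=> ng nf cfg hab hbc hcd hd fab fcd gad fbc gbc.
have [[pf cf] [pg _]] := (nf, ng).
have fba : f b = a by rewrite -fab; have [] := pf a ltac:(lia).
have fdc : f d = c by rewrite -fcd; have [] := pf c ltac:(lia).
have fad : fenced f a d.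
  move=> x hx; have := @fenced_chord n f f a cf; have := @fenced_chord n f f c cf.
  rewrite fab fcd => h1 h2.
  have := h1 ltac:(lia) ltac:(lia) x; have := h2 ltac:(lia) ltac:(lia) x.
  have := fbc x; case: (eqVneq x b) => [->|?]; first lia.
  case: (eqVneq x c) => [->|?]; lia.
split.
  apply: flip_ncm => //; try lia; first by split; lia.
  - by apply: fencedP => //; lia.
  - by apply: fencedP => //; lia.
  - by apply: ncrossI; lia.
by apply: flip_compatible => //; apply: fencedP => //; lia.
Qed.

(** The inverse move: the nested edges [ad], [bc] become [ab], [cd], which needs a fence around each
    of the two gaps beside [bc]. *)
Lemma flip_unnest n f g a b c d : ncm n g -> ncm n f -> compatible n f g ->
  a < b -> b < c -> c < d -> d < n -> f a = d -> f b = c ->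
  fenced f a b -> fenced g a b -> fenced f c d -> fenced g c d ->
  ncm n (flip f a d c b) /\ compatible n (flip f a d c b) g.
Proof.
move=> ng nf cfg hab hbc hcd hd fad fbc fab gab fcd gcd.
have [[pf cf] [pg _]] := (nf, ng).
have fcb : f c = b by rewrite -fbc; have [] := pf b ltac:(lia).
split.
  apply: flip_ncm => //; try lia; first by split; lia.
  - by apply: fencedP => //; lia.
  - by apply: uncrossedC; apply: fencedP => //; lia.
  - by rewrite cross_swapr; apply: ncrossI; lia.
apply: flip_compatible => //; last apply: uncrossedC; apply: fencedP => //; lia.
Qed.

(** * The pair below an edge of [f] *)

Lemma fenced_consecutive f a b : b = a.+1 -> fenced f a b.
Proof. by move=> -> x; lia. Qed.

(** At the extreme points [p.+1] and [r] the edges of [g] must reach farther inwards than those of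
    [f], or else an edge of [f] could be unnested from the edge at [p]. If they were then two
    different edges, they could be nested. Each flip would give a forbidden neighbour. *)
Lemma outermost_inner_edge n f g p r : isolated_pair n f g ->
  p < r -> r.+1 < n -> f p = r.+1 -> preserves g p.+1 r.+1 -> g p.+1 = r.
Proof.
move=> U hpr hr fp cg.
have [nf ng cfg dfg _ _] := U; have cgf := compatibleC cfg.
have [[pf cf] [pg cg']] := (nf, ng).
have [_ fr _] := pf p ltac:(lia); rewrite fp in fr.
have fen : fenced f p r.+1 by rewrite -fp; apply: fenced_chord cf _ _; lia.
have cf1 : preserves f p.+1 r.+1.
  move=> x hx; have := fen x ltac:(lia); have [_ e _] := pf x ltac:(lia).
  case: (eqVneq (f x) p) => [ex|n1]; first by rewrite ex fp in e; lia.
  case: (eqVneq (f x) r.+1) => [ex|n2]; last lia.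
  by rewrite ex fr in e; lia.
have [fL1 fL2 fL3] := pf p.+1 ltac:(lia).
have [gL1 gL2 gL3] := pg p.+1 ltac:(lia).
have [fR1 fR2 fR3] := pf r ltac:(lia).
have [gR1 gR2 gR3] := pg r ltac:(lia).
have dL := dfg p.+1 ltac:(lia); have dR := dfg r ltac:(lia).
have bfL := cf1 p.+1 ltac:(lia); have bgL := cg p.+1 ltac:(lia).
have bfR := cf1 r ltac:(lia); have bgR := cg r ltac:(lia).
(* Otherwise the edges of [f] at [p] and [p.+1] are replaced by [(p, p.+1)] and [(b, r.+1)]. Neither
   is in [g], for which the range from [p.+1] to [r] is stable. *)
have hL : f p.+1 < g p.+1.
  case: (ltnP (f p.+1) (g p.+1)) => // hle; exfalso.
  set b := f p.+1 in hle *.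
  have fenb := fenced_chord cf (a := p.+1) ltac:(lia) ltac:(lia).
  have genb := fenced_chord cfg (a := p.+1) ltac:(lia) ltac:(lia).
  rewrite -/b in fenb genb.
  have gb := (same_side nf ng cfg (a := p.+1) (b := b) ltac:(lia) ltac:(lia) erefl).1 ltac:(lia).
  have fb' : fenced f b r.+1.
    move=> x hx; have := cf1 x ltac:(lia); have [_ e _] := pf x ltac:(lia).
    case: (leqP b (f x)) => [|hlt]; first lia.
    case: (eqVneq (f x) p.+1) => [ex|n1]; first by rewrite ex -/b in e; lia.
    by have := fenb (f x); rewrite e; lia.
  have gb' : fenced g b r.+1.
    move=> x hx; have := cg x ltac:(lia); have [_ e _] := pg x ltac:(lia).
    case: (leqP b (g x)) => [|hlt]; first lia.
    case: (eqVneq (g x) p.+1) => [ex|n1]; first by rewrite ex in e; lia.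
    by have := genb (g x); rewrite e; lia.
  have [h1 h2] : ncm n (flip f p r.+1 b p.+1) /\ compatible n (flip f p r.+1 b p.+1) g.
    by apply: flip_unnest => //; try exact: fenced_consecutive; lia.
  apply: (isolated_pair_no_other (x := p) U h1 h2) => [x hx||]; rewrite /flip ?eqxx; try lia.
  case: eqP => [->|n1]; first by move=> e; have [_ ] := pg p ltac:(lia); rewrite -e; lia.
  case: eqP => [->|n2]; first lia.
  case: eqP => [->|n3]; first by move=> e; have [_ ] := pg r.+1 ltac:(lia); rewrite -e; lia.
  by case: eqP => [->|n4]; [lia | exact: dfg].
(* The mirror image, with new edges [(p, b)] and [(r, r.+1)]. *)
have hR : g r < f r.
  case: (ltnP (g r) (f r)) => // hle; exfalso.
  set b := f r in fR1 fR2 fR3 dR bfR hle *.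
  have fenb := fenced_chord cf (a := b) ltac:(lia) ltac:(lia).
  have genb := fenced_chord cfg (a := b) ltac:(lia) ltac:(lia).
  rewrite fR2 in fenb genb.
  have gb := (same_side nf ng cfg (a := b) (b := r) ltac:(lia) ltac:(lia) fR2).2 ltac:(lia).
  have fb' : fenced f p b.
    move=> x hx; have := cf1 x ltac:(lia); have [_ e _] := pf x ltac:(lia).
    case: (leqP (f x) b) => [|hlt]; first lia.
    case: (eqVneq (f x) r) => [ex|n1]; first by rewrite ex -/b in e; lia.
    by have := fenb (f x); rewrite e; lia.
  have gb' : fenced g p b.
    move=> x hx; have := cg x ltac:(lia); have [_ e _] := pg x ltac:(lia).
    case: (leqP (g x) b) => [|hlt]; first lia.
    case: (eqVneq (g x) r) => [ex|n1]; first by rewrite ex in e; lia.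
    by have := genb (g x); rewrite e; lia.
  have [h1 h2] : ncm n (flip f p r.+1 r b) /\ compatible n (flip f p r.+1 r b) g.
    by apply: flip_unnest => //; try exact: fenced_consecutive; lia.
  apply: (isolated_pair_no_other (x := p) U h1 h2) => [x hx||]; rewrite /flip ?eqxx; try lia.
  case: eqP => [->|n1]; first by move=> e; have [_ ] := pg p ltac:(lia); rewrite -e; lia.
  case: eqP => [->|n2]; first lia.
  case: eqP => [->|n3]; first by move=> e; have [_ ] := pg r.+1 ltac:(lia); rewrite -e; lia.
  by case: eqP => [->|n4]; [lia | exact: dfg].
(* The edges [(p.+1, c)] and [(d, r)] of [g] now lie side by side. Nesting them creates [(p.+1, r)]
   and [(c, d)], which are not in [f] because [f p.+1] and [f c] are both smaller than [c]. *)
case: (eqVneq (g p.+1) r) => // ne; exfalso.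
set c := g p.+1 in hL bgL gL1 gL2 gL3 dL ne *; set d := g r in hR bgR gR1 gR2 gR3 dR *.
have hcd : c < d.
  have h1 := fenced_chord cg' (a := p.+1) ltac:(lia) ltac:(lia).
  have := h1 d; rewrite -/c gR2.
  case: (eqVneq d c) => [e|n1]; first by rewrite e gL2 in gR2; lia.
  case: (eqVneq d p.+1) => [e|n2]; first by rewrite e -/c in gR2; lia.
  lia.
have fenc := fenced_chord cgf (a := p.+1) ltac:(lia) ltac:(lia).
have fend := fenced_chord cgf (a := d) ltac:(lia) ltac:(lia).
have genc := fenced_chord cg' (a := p.+1) ltac:(lia) ltac:(lia).
have gend := fenced_chord cg' (a := d) ltac:(lia) ltac:(lia).
rewrite gR2 in fend gend; rewrite -/c in fenc genc.
have fc := (same_side ng nf cgf (a := p.+1) (b := c) ltac:(lia) ltac:(lia) erefl).1 ltac:(lia).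
have fd := (same_side ng nf cgf (a := d) (b := r) ltac:(lia) ltac:(lia) gR2).2 ltac:(lia).
have fcd : fenced f c d.
  move=> x hx; have := cf1 x ltac:(lia); have [_ e _] := pf x ltac:(lia).
  case: (eqVneq (f x) p.+1) => [ex|n1]; first by rewrite ex in e; lia.
  case: (eqVneq (f x) r) => [ex|n2]; first by rewrite ex in e; lia.
  by have := fenc (f x); have := fend (f x); rewrite e; lia.
have gcd : fenced g c d.
  move=> x hx; have := cg x ltac:(lia); have [_ e _] := pg x ltac:(lia).
  case: (eqVneq (g x) p.+1) => [ex|n1]; first by rewrite ex -/c in e; lia.
  case: (eqVneq (g x) r) => [ex|n2]; first by rewrite ex -/d in e; lia.
  by have := genc (g x); have := gend (g x); rewrite e; lia.
have fpr : fenced f p.+1 r.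
  by move=> x hx; have := cf1 x; lia.
have [h1 h2] : ncm n (flip g p.+1 c d r) /\ compatible n (flip g p.+1 c d r) f.
  by apply: flip_nest => //; lia.
apply: (isolated_pair_no_other (x := p.+1) (isolated_pairC U) h1 h2) => [x hx||];
  rewrite /flip ?eqxx; try lia.
case: eqP => [->|n1]; first lia.
case: eqP => [->|n2]; first lia.
case: eqP => [->|n3]; first lia.
case: eqP => [->|n4]; [lia | exact: (edge_disjointC dfg)].
Qed.

(** * Chains *)
(* Each step surrounds the matched interval by four new points, as
     f : ()(...)   g : (()...)      or      f : (...)()   g : (...()). *)
Inductive chain (f g : nat -> nat) : nat -> nat -> Prop :=
| ChainNil a : chain f g a a
| ChainL a b : chain f g a.+3 b ->
    f a = a.+1 -> f a.+1 = a -> f a.+2 = b -> f b = a.+2 ->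
    g a = b -> g b = a -> g a.+1 = a.+2 -> g a.+2 = a.+1 -> chain f g a b.+1
| ChainR a b : chain f g a.+1 b ->
    f a = b -> f b = a -> f b.+1 = b.+2 -> f b.+2 = b.+1 ->
    g a = b.+2 -> g b.+2 = a -> g b = b.+1 -> g b.+1 = b -> chain f g a b.+3.

(** An edge starting in a gap cannot end at a corner, since the corners are matched among
    themselves, and cannot cross [Lu] or [vR]; the middle gap is what remains. *)
Lemma quad_gaps n h L u v R : pairing n h -> L < u -> u < v -> v < R -> R < n ->
  preserves h L R.+1 ->
  (forall x, x \in [:: L; u; v; R] -> h x \in [:: L; u; v; R]) ->
  fenced h L u -> fenced h v R ->
  [/\ preserves h L.+1 u, preserves h u.+1 v & preserves h v.+1 R].
Proof.
move=> ph Lu uv vR Rn hLR hq hLu hvR.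
have out x : L <= x <= R -> x \notin [:: L; u; v; R] ->
    L <= h x <= R /\ h x \notin [:: L; u; v; R].
  move=> hx nx; split; first by have := hLR x; lia.
  by apply: contra nx => /hq; have [_ -> _] := ph x ltac:(lia).
split=> x hx; have := out x; have := hLu x; have := hvR x;
  have := hLu (h x); have := hvR (h x); have [_ -> _] := ph x ltac:(lia);
  rewrite !inE; lia.
Qed.

(** Two flips in a row: [(p.+1, u)], [(v, r)] are nested into [(p.+1, r)], [(u, v)], and then
    [(p, r.+1)], [(p.+1, r)] are opened into [(p, p.+1)], [(r, r.+1)]. The intermediate matching may
    share [(p.+1, r)] with [g]; the final one has lost that edge. *)
Lemma flip_through n f g p r (u := f p.+1) (v := f r)
  (h := flip (flip f p.+1 u v r) p r.+1 r p.+1) :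
  ncm n f -> ncm n g -> compatible n f g ->
  r.+1 < n -> f p = r.+1 -> p.+1 < u -> u < v -> v < r ->
  fenced g p.+1 r -> fenced f u v -> fenced g u v ->
  ncm n h /\ compatible n h g.
Proof.
move=> nf ng cfg hr fp pu uv vr gLR fuv guv.
have [_ fL _] := nf.1 p.+1 ltac:(lia); have [_ fR _] := nf.1 r ltac:(lia).
have [n1 c1] : ncm n (flip f p.+1 u v r) /\ compatible n (flip f p.+1 u v r) g.
  by apply: flip_nest => //; lia.
apply: flip_unnest => //; try exact: fenced_consecutive; try lia.
  by rewrite /flip; do ?case: eqP; lia.
by rewrite /flip; do ?case: eqP; lia.
Qed.

Lemma innermost_quad n f g p r : isolated_pair n f g ->
  p < r -> r.+1 < n -> f p = r.+1 -> preserves g p.+1 r.+1 ->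
  [/\ g p.+1 = r, p.+1 < f p.+1, f p.+1 < f r, f r < r & g (f p.+1) = f r].
Proof.
move=> U hpr hr fp cg; have gL := outermost_inner_edge U hpr hr fp cg.
have [nf ng cfg dfg _ _] := U; have cgf := compatibleC cfg.
have [[pf cf] [pg cg']] := (nf, ng).
have [_ fr _] := pf p ltac:(lia); rewrite fp in fr.
have [_ gR _] := pg p.+1 ltac:(lia); rewrite gL in gR.
have fen : fenced f p r.+1 by rewrite -fp; apply: fenced_chord cf _ _; lia.
have [fL1 fL2 fL3] := pf p.+1 ltac:(lia); have [fR1 fR2 fR3] := pf r ltac:(lia).
have dL := dfg p.+1 ltac:(lia); have dR := dfg r ltac:(lia).
have bL := fen p.+1 ltac:(lia); have bR := fen r ltac:(lia).
have gp := pg p ltac:(lia); have gq := pg r.+1 ltac:(lia).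
set u := f p.+1 in fL1 fL2 fL3 dL bL *; set v := f r in fR1 fR2 fR3 dR bR *.
have up : u <> p by move=> e; rewrite e in fL2; lia.
have uq : u <> r.+1 by move=> e; rewrite e in fL2; lia.
have vp : v <> p by move=> e; rewrite e in fR2; lia.
have vq : v <> r.+1 by move=> e; rewrite e in fR2; lia.
have uv' : u <> v by move=> e; rewrite e in fL2; lia.
have vL : v <> p.+1 by move=> e; rewrite e -/u in fR2; lia.
have fLu : fenced f p.+1 u by apply: fenced_chord cf _ _; lia.
have gLu : fenced g p.+1 u by apply: fenced_chord cfg _ _; lia.
have fvR : fenced f v r by rewrite -{1}fR2; apply: fenced_chord cf _ _; lia.
have gvR : fenced g v r by rewrite -{1}fR2; apply: fenced_chord cfg _ _; lia.
have uv : u < v by have := fLu v; lia.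
split=> //; try lia.
(* If [uv] were not in [g], the outcome of [flip_through] would be disjoint from [g]: its other new
   edges join [p] and [r.+1] to points that [g] matches inside. *)
case: (eqVneq (g u) v) => // nuv; exfalso.
have fuv : fenced f u v.
  move=> x hx; have := fen x; have [_ e _] := pf x ltac:(lia).
  have := fLu (f x); have := fvR (f x); rewrite e.
  case: (eqVneq (f x) p) => [ex|?]; first by rewrite ex in e; lia.
  case: (eqVneq (f x) p.+1) => [ex|?]; first by rewrite ex -/u in e; lia.
  case: (eqVneq (f x) r) => [ex|?]; first by rewrite ex -/v in e; lia.
  case: (eqVneq (f x) r.+1) => [ex|?]; first by rewrite ex in e; lia.
  lia.
have guv : fenced g u v.
  move=> x hx; have := cg x; have [_ e _] := pg x ltac:(lia).
  have := gLu (g x); have := gvR (g x); rewrite e.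
  case: (eqVneq (g x) p.+1) => [ex|?]; first by rewrite ex in e; lia.
  case: (eqVneq (g x) r) => [ex|?]; first by rewrite ex in e; lia.
  lia.
have gLR : fenced g p.+1 r by move=> x; have := cg x; lia.
have [n2 c2] := flip_through nf ng cfg hr fp ltac:(lia) uv ltac:(lia) gLR fuv guv.
rewrite -/u -/v in n2 c2; set f1 := flip f p.+1 u v r in n2 c2.
have guu := pg u ltac:(lia); have gvv := pg v ltac:(lia).
apply: (isolated_pair_no_other (x := p) U n2 c2) => [x hx||];
  rewrite ?[flip f1 _ _ _ _ _]/flip ?eqxx; try lia.
case: eqP => [->|?]; first by move=> e; move: gp; rewrite -e => -[]; lia.
case: eqP => [->|?]; first by lia.
case: eqP => [->|?]; first by move=> e; move: gq; rewrite -e => -[]; lia.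
case: eqP => [->|?]; first by lia.
rewrite /f1 /flip.
case: eqP => [?|?]; first lia.
case: eqP => [?|?]; first lia.
case: eqP => [->|?]; first by lia.
case: eqP => [->|?]; first by move=> e; move: gvv; rewrite -e => -[]; lia.
exact: dfg.
Qed.

(** The outer gaps lie below edges of [f] and the middle one below the edge [uv] of [g], so
    stability makes [outermost_inner_edge] applicable again in each of them. *)
Lemma innermost_gaps n f g p r : isolated_pair n f g ->
  p < r -> r.+1 < n -> f p = r.+1 -> preserves g p.+1 r.+1 ->
  let u := f p.+1 in let v := f r in
  [/\ preserves f p.+2 u, preserves f u.+1 v & preserves f v.+1 r] /\
  [/\ preserves g p.+2 u, preserves g u.+1 v & preserves g v.+1 r].
Proof.
move=> U hpr hr fp cg u v.
have [gL Lu uv vR gu] := innermost_quad U hpr hr fp cg.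
rewrite -/u -/v in Lu uv vR gu.
have [nf ng cfg dfg _ _] := U; have cgf := compatibleC cfg.
have [[pf cf] [pg cg']] := (nf, ng).
have [_ fq _] := pf p ltac:(lia); rewrite fp in fq.
have [_ gR _] := pg p.+1 ltac:(lia); rewrite gL in gR.
have [_ gv _] := pg u ltac:(lia); rewrite gu in gv.
have [_ fL _] := pf p.+1 ltac:(lia); have [_ fR _] := pf r ltac:(lia).
rewrite -/u -/v in fL fR.
have fen : fenced f p r.+1 by rewrite -fp; apply: fenced_chord cf _ _; lia.
have cf1 : preserves f p.+1 r.+1.
  move=> x hx; have := fen x; have [_ e _] := pf x ltac:(lia).
  case: (eqVneq (f x) p) => [ex|?]; first by rewrite ex in e; lia.
  case: (eqVneq (f x) r.+1) => [ex|?]; first by rewrite ex in e; lia.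
  lia.
split.
  apply: (quad_gaps pf Lu uv vR) => //; first lia.
  - move=> x; rewrite !inE => /or4P[] /eqP ->; rewrite ?fL ?fR -/u -/v ?eqxx ?orbT //.
  - by apply: fenced_chord cf _ _; lia.
  - by rewrite -{1}fR; apply: fenced_chord cf _ _; lia.
apply: (quad_gaps pg Lu uv vR) => //; first lia.
- by move=> x; rewrite !inE => /or4P[] /eqP ->; rewrite ?gL ?gR ?gu ?gv ?eqxx ?orbT.
- by apply: fenced_chord cfg _ _; lia.
- by rewrite -{1}fR; apply: fenced_chord cfg _ _; lia.
Qed.

Lemma preserves_fenced h a b : preserves h a.+1 b -> fenced h a b.
Proof. by move=> ph x hx; have := ph x; lia. Qed.

(** If the gap below [uv] had points, [f] would join its extreme ones. [flip_through] creates the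
    edge [uv], shared with [g]; opening it against this inner edge removes it again and gives a
    further neighbour of [g]. *)
Lemma innermost_middle n f g p r : isolated_pair n f g ->
  p < r -> r.+1 < n -> f p = r.+1 -> preserves g p.+1 r.+1 ->
  f r = (f p.+1).+1.
Proof.
move=> U hpr hr fp cg.
have [gL Lu uv vR gu] := innermost_quad U hpr hr fp cg.
have [[_ fm _] [_ gm _]] := innermost_gaps U hpr hr fp cg.
have [nf ng cfg dfg _ _] := U.
have [[pf cf] [pg cg']] := (nf, ng).
have [_ fL _] := pf p.+1 ltac:(lia); have [_ fR _] := pf r ltac:(lia).
have gLR : fenced g p.+1 r by move=> x; have := cg x; lia.
have [n2 c2] := flip_through nf ng cfg hr fp Lu uv vR gLR
  (preserves_fenced fm) (preserves_fenced gm).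
set u := f p.+1 in Lu uv gu fm gm fL n2 c2 *.
set v := f r in uv vR gu fm gm fR n2 c2 *.
have [_ gv _] := pg u ltac:(lia); rewrite gu in gv.
have [_ gR _] := pg p.+1 ltac:(lia); rewrite gL in gR.
case: (eqVneq v u.+1) => // nuv; exfalso.
have [v' ev] : {v' | v = v'.+1} by exists v.-1; lia.
have fu1 : f u.+1 = v'.
  by apply: (outermost_inner_edge (isolated_pairC U)); rewrite -?ev //; lia.
have [_ fv' nu1] := pf u.+1 ltac:(lia); rewrite fu1 in fv' nu1.
have gu1 := gm u.+1 ltac:(lia); have gv1 := gm v' ltac:(lia).
have gp := pg p ltac:(lia); have gq := pg r.+1 ltac:(lia).
set f1 := flip f p.+1 u v r in n2 c2; set f2 := flip f1 _ _ _ _ in n2 c2.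
have [n3 c3] : ncm n (flip f2 u v v' u.+1) /\ compatible n (flip f2 u v v' u.+1) g.
  apply: flip_unnest => //; try exact: fenced_consecutive; try lia.
    by rewrite /f2 /f1 /flip; do ?case: eqP; lia.
  by rewrite /f2 /f1 /flip; do ?case: eqP; lia.
apply: (isolated_pair_no_other (x := p) U n3 c3) => [x hx||].
- rewrite /flip; case: eqP => [->|?]; first lia.
  case: eqP => [->|?]; first lia.
  case: eqP => [->|?]; first lia.
  case: eqP => [->|?]; first lia.
  rewrite /f2 /flip.
  case: eqP => [->|?]; first by move=> e; move: gp; rewrite -e => -[]; lia.
  case: eqP => [->|?]; first lia.
  case: eqP => [->|?]; first by move=> e; move: gq; rewrite -e => -[]; lia.
  case: eqP => [->|?]; first lia.
  rewrite /f1 /flip; do 4 (case: eqP => [?|?]; first lia).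
  exact: dfg.
- lia.
by rewrite /f2 /flip eqxx; do ?case: eqP; lia.
Qed.

(** If both outer gaps had points, [g] would join the extreme points of each. Flipping the
    quadrilateral in [g] creates the edges [(p.+1, u)] and [(v, r)] of [f]; opening each against the
    edge of [g] just below it removes both, which gives a further neighbour of [f]. *)
Lemma innermost_side n f g p r : isolated_pair n f g ->
  p < r -> r.+1 < n -> f p = r.+1 -> preserves g p.+1 r.+1 ->
  f p.+1 = p.+2 \/ (f r).+1 = r.
Proof.
move=> U hpr hr fp cg.
have [gL Lu uv vR gu] := innermost_quad U hpr hr fp cg.
have [[f1 _ f3] [g1 _ g3]] := innermost_gaps U hpr hr fp cg.
have [nf ng cfg dfg _ _] := U.
have [[pf cf] [pg cg']] := (nf, ng).
have [_ fL _] := pf p.+1 ltac:(lia); have [_ fR _] := pf r ltac:(lia).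
set u := f p.+1 in Lu uv gu f1 g1 fL *; set v := f r in uv vR gu f3 g3 fR *.
have [_ gv _] := pg u ltac:(lia); rewrite gu in gv.
have [_ gR _] := pg p.+1 ltac:(lia); rewrite gL in gR.
case: (eqVneq u p.+2) => [|nu]; first by left.
case: (eqVneq v.+1 r) => [|nv]; [by right | exfalso].
have [u' eu] : {u' | u = u'.+1} by exists u.-1; lia.
have [r' er] : {r' | r = r'.+1} by exists r.-1; lia.
have gL1 : g p.+2 = u'.
  by apply: (outermost_inner_edge U); rewrite -?eu //; lia.
have gv1 : g v.+1 = r'.
  by apply: (outermost_inner_edge U); rewrite -?er //; lia.
have [_ gu' nL1] := pg p.+2 ltac:(lia); rewrite gL1 in gu' nL1.
have [_ gr' nv1] := pg v.+1 ltac:(lia); rewrite gv1 in gr' nv1.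
have k1 := f1 p.+2 ltac:(lia); have k2 := f1 u' ltac:(lia).
have k3 := f3 v.+1 ltac:(lia); have k4 := f3 r' ltac:(lia).
have cgf := compatibleC cfg.
have [n1 c1] : ncm n (flip g p.+1 r v u) /\ compatible n (flip g p.+1 r v u) f.
  by apply: flip_unnest => //; try exact: preserves_fenced; lia.
set h1 := flip g p.+1 r v u in n1 c1.
have [n2 c2] : ncm n (flip h1 p.+1 u u' p.+2) /\ compatible n (flip h1 p.+1 u u' p.+2) f.
  apply: flip_unnest => //; try exact: fenced_consecutive; try lia.
    by rewrite /h1 /flip; do ?case: eqP; lia.
  by rewrite /h1 /flip; do ?case: eqP; lia.
set h2 := flip h1 p.+1 u u' p.+2 in n2 c2.
have [n3 c3] : ncm n (flip h2 v r r' v.+1) /\ compatible n (flip h2 v r r' v.+1) f.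
  apply: flip_unnest => //; try exact: fenced_consecutive; try lia.
    by rewrite /h2 /h1 /flip; do ?case: eqP; lia.
  by rewrite /h2 /h1 /flip; do ?case: eqP; lia.
apply: (isolated_pair_no_other (x := v) (isolated_pairC U) n3 c3) => [x hx||].
- rewrite /flip; do 4 (case: eqP => [->|?]; first lia).
  rewrite /h2 /flip; do 4 (case: eqP => [->|?]; first lia).
  rewrite /h1 /flip; do 4 (case: eqP => [?|?]; first lia).
  exact: (edge_disjointC dfg).
- lia.
by rewrite /flip eqxx; lia.
Qed.

Lemma isolated_pair_chain n f g p r : isolated_pair n f g ->
  p <= r -> r.+1 < n -> f p = r.+1 -> preserves g p.+1 r.+1 ->
  chain f g p.+1 r.+1.
Proof.
move=> U; have [m] := ubnP (r - p); elim: m p r => // m IH p r hm hpr hr fp cg.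
case: (eqVneq p r) => [->|npr]; first exact: ChainNil.
have {npr}hpr : p < r by lia.
have [gL Lu uv vR gu] := innermost_quad U hpr hr fp cg.
have [_ [g1 _ g3]] := innermost_gaps U hpr hr fp cg.
have em := innermost_middle U hpr hr fp cg.
have [nf ng _ _ _ _] := U; have [[pf _] [pg _]] := (nf, ng).
have [_ fL _] := pf p.+1 ltac:(lia); have [_ fR _] := pf r ltac:(lia).
have [_ gv _] := pg (f p.+1) ltac:(lia); rewrite gu in gv.
have [_ gR _] := pg p.+1 ltac:(lia); rewrite gL in gR.
(* The rest of the chain lies in the remaining gap, below the edge of [f] from [p.+3] to [r] in the
   first case and from [p.+1] to [f p.+1] in the second. *)
case: (innermost_side U hpr hr fp cg) => es.
  rewrite es in em fL gu gv g1 Lu uv.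
  have [r' er] : {r' | r = r'.+1} by exists r.-1; lia.
  apply: ChainL => //; rewrite -?em //.
  rewrite em in g3 fR *; rewrite er; apply: IH; rewrite -?er //; lia.
have [u eu] : {u | f p.+1 = u.+1} by exists (f p.+1).-1; lia.
rewrite eu in em fL gu gv g1 Lu uv; rewrite em in es fR gu gv vR.
have er : r = u.+3 by lia.
rewrite er in gL gR fR em *.
apply: ChainR => //; try lia.
by apply: IH => //; lia.
Qed.

(** * Rotations *)
(** A relation on the points below [n], so that rotations can be inverted and composed without
    comparing functions outside that range. *)
Definition rotated n r (f f' : nat -> nat) := forall x, x < n ->
  [/\ f' x < n, f x < n & f (tau n r x) = tau n r (f' x)].

Definition rot_fun n r (f : nat -> nat) x := tau n (n - r) (f (tau n r x)).

Lemma rot_funP n r f : r <= n -> pairing n f -> rotated n r f (rot_fun n r f).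
Proof.
move=> hr pf x hx; have [f1 _ _] := pf x hx; rewrite /rot_fun.
have [f2 _ _] := pf _ (tau_lt hr hx).
by split=> //; [apply: tau_lt; lia | rewrite tauKV].
Qed.

Lemma rotatedC n r f f' : r <= n -> rotated n r f f' -> rotated n (n - r) f' f.
Proof.
move=> hr R x hx; have [h1 h2 _] := R x hx; split=> //.
have hy : tau n (n - r) x < n by apply: tau_lt; lia.
have [h3 _ h4] := R _ hy.
by rewrite tauKV // in h4; rewrite h4 tauK.
Qed.

Lemma rotated_pairing n r f f' : r <= n -> rotated n r f f' -> pairing n f ->
  pairing n f'.
Proof.
move=> hr R pf x hx; have hx' := tau_lt hr hx; have [_ ff nf] := pf _ hx'.
have [h1 _ h2] := R x hx; have [h3 _ h4] := R _ h1.
rewrite h2 h4 in ff; rewrite h2 in nf.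
split=> //; last by move=> e; rewrite e in nf.
by apply/eqP; rewrite -(tau_inj hr) //; apply/eqP.
Qed.

Lemma rotated_compatible n r f f' g g' : r <= n -> rotated n r f f' ->
  rotated n r g g' -> compatible n f g -> compatible n f' g'.
Proof.
move=> hr Rf Rg c x y hx hy; have [h1 _ h2] := Rf x hx; have [h3 _ h4] := Rg y hy.
by rewrite -(cross_tau hr) // -h2 -h4; apply: c; apply: tau_lt.
Qed.

Lemma rotated_ncm n r f f' : r <= n -> rotated n r f f' -> ncm n f -> ncm n f'.
Proof.
move=> hr R [pf cf]; split; [exact: (rotated_pairing hr R pf)|].
exact: (rotated_compatible hr R R cf).
Qed.

Lemma rotated_disjoint n r f f' g g' : r <= n -> rotated n r f f' ->
  rotated n r g g' -> edge_disjoint n f g -> edge_disjoint n f' g'.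
Proof.
move=> hr Rf Rg d x hx e; apply: (d _ (tau_lt hr hx)).
by have [_ _ ->] := Rf x hx; have [_ _ ->] := Rg x hx; rewrite e.
Qed.

(** A neighbour of [f'] is turned back by [n - r] into a neighbour of [f]. *)
Lemma rotated_sole n r f f' g g' : r <= n -> rotated n r f f' ->
  rotated n r g g' -> sole_neighbour n f g -> sole_neighbour n f' g'.
Proof.
move=> hr Rf Rg S h nh ch dh x hx.
have hr' : n - r <= n by lia.
have [Rf' Rh] := (rotatedC hr Rf, rot_funP hr' nh.1).
have nh' := rotated_ncm hr' Rh nh.
have := S _ nh' (rotated_compatible hr' Rf' Rh ch) (rotated_disjoint hr' Rf' Rh dh).
move/(_ _ (tau_lt hr hx)).
rewrite /rot_fun subKn // tauK //; have [h1 _ ->] := Rg x hx => /eqP.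
by rewrite tau_inj //; [move/eqP | have [] := nh.1 x hx].
Qed.

Lemma isolated_pair_rotated n r f f' g g' : r <= n -> rotated n r f f' ->
  rotated n r g g' -> isolated_pair n f g -> isolated_pair n f' g'.
Proof.
move=> hr Rf Rg [nf ng c d s1 s2]; split.
- exact: (rotated_ncm hr Rf nf).
- exact: (rotated_ncm hr Rg ng).
- exact: (rotated_compatible hr Rf Rg c).
- exact: (rotated_disjoint hr Rf Rg d).
- exact: (rotated_sole hr Rf Rg s1).
- exact: (rotated_sole hr Rg Rf s2).
Qed.

(** * Chains form isolated pairs *)

Lemma ncross_separated c d x x' y y' : c <= y < d -> c <= y' < d ->
  ~~ (c <= x < d) -> ~~ (c <= x' < d) -> ~~ cross x x' y y'.
Proof. rewrite /cross /strictly_between; lia. Qed.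

Definition compatible_on (f g : nat -> nat) a b :=
  forall x y, a <= x < b -> a <= y < b -> ~~ cross x (f x) y (g y).

(** Edges inside a stable interval cannot cross edges outside it, so each chain step only has to
    test its new points, listed in [S]. *)
Lemma compatible_on_extend f g c d (S : seq nat) a b :
  (forall x, a <= x < b -> c <= x < d \/ x \in S) ->
  preserves f c d -> preserves g c d -> compatible_on f g c d ->
  (forall x, x \in S -> [&& ~~ (c <= x < d), ~~ (c <= f x < d) & ~~ (c <= g x < d)]) ->
  (forall x y, x \in S -> y \in S -> ~~ cross x (f x) y (g y)) ->
  compatible_on f g a b.
Proof.
move=> cover pf pg cin out cout x y /cover[hx|hx] /cover[hy|hy].
- exact: cin.
- have /and3P[h1 h2 h3] := out y hy; rewrite crossC.
  by apply: (@ncross_separated c d) => //; exact: pf.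
- have /and3P[h1 h2 h3] := out x hx.
  by apply: (@ncross_separated c d) => //; exact: pg.
- exact: cout.
Qed.

Definition pairing_on (f : nat -> nat) a b :=
  forall x, a <= x < b -> [/\ a <= f x < b, f (f x) = x & f x <> x].

Record isolated_on (f g : nat -> nat) a b : Prop := IsolatedOn {
  on_le : a <= b;
  on_pairingl : pairing_on f a b;
  on_pairingr : pairing_on g a b;
  on_disjoint x : a <= x < b -> f x <> g x;
  on_ncrossl : compatible_on f f a b;
  on_ncross : compatible_on f g a b;
  on_ncrossr : compatible_on g g a b }.

Lemma pairing_on_preserves f a b : pairing_on f a b -> preserves f a b.
Proof. by move=> p x /p[]. Qed.

Lemma chain_isolated_on f g a b : chain f g a b -> isolated_on f g a b.
Proof.
elim=> {a b} [a|a b _ [ab pf pg d cf c cg] e1 e2 e3 e4 e5 e6 e7 e8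
             |a b _ [ab pf pg d cf c cg] e1 e2 e3 e4 e5 e6 e7 e8].
- by split=> [|x|x|x|x y|x y|x y]; lia.
- have cover x : a <= x < b.+1 -> a.+3 <= x < b \/ x \in [:: a; a.+1; a.+2; b].
    by rewrite !inE; lia.
  have [kf kg] := (pairing_on_preserves pf, pairing_on_preserves pg).
  split; first lia.
  + move=> x /cover[/pf[]|]; first by split; lia.
    by rewrite !inE => /or4P[] /eqP ->; split; rewrite ?e1 ?e2 ?e3 ?e4; lia.
  + move=> x /cover[/pg[]|]; first by split; lia.
    by rewrite !inE => /or4P[] /eqP ->; split; rewrite ?e5 ?e7 ?e8 ?e6; lia.
  + move=> x /cover[/d //|]; rewrite !inE => /or4P[] /eqP ->; lia.
  + apply: (compatible_on_extend cover) => // [x|x y]; rewrite !inE => /or4P[] /eqP ->.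
    1-4: lia.
    1-4: by move=> /or4P[] /eqP ->; rewrite ?e1 ?e2 ?e3 ?e4 /cross /strictly_between; lia.
  + apply: (compatible_on_extend cover) => // [x|x y]; rewrite !inE => /or4P[] /eqP ->.
    1-4: lia.
    1-4: move=> /or4P[] /eqP ->; rewrite ?e1 ?e2 ?e3 ?e4 ?e5 ?e6 ?e7 ?e8;
      rewrite /cross /strictly_between; lia.
  + apply: (compatible_on_extend cover) => // [x|x y]; rewrite !inE => /or4P[] /eqP ->.
    1-4: lia.
    1-4: by move=> /or4P[] /eqP ->; rewrite ?e5 ?e6 ?e7 ?e8 /cross /strictly_between; lia.
- have cover x : a <= x < b.+3 -> a.+1 <= x < b \/ x \in [:: a; b; b.+1; b.+2].
    by rewrite !inE; lia.
  have [kf kg] := (pairing_on_preserves pf, pairing_on_preserves pg).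
  split; first lia.
  + move=> x /cover[/pf[]|]; first by split; lia.
    by rewrite !inE => /or4P[] /eqP ->; split; rewrite ?e1 ?e2 ?e3 ?e4; lia.
  + move=> x /cover[/pg[]|]; first by split; lia.
    by rewrite !inE => /or4P[] /eqP ->; split; rewrite ?e5 ?e7 ?e8 ?e6; lia.
  + move=> x /cover[/d //|]; rewrite !inE => /or4P[] /eqP ->; lia.
  + apply: (compatible_on_extend cover) => // [x|x y]; rewrite !inE => /or4P[] /eqP ->.
    1-4: lia.
    1-4: by move=> /or4P[] /eqP ->; rewrite ?e1 ?e2 ?e3 ?e4 /cross /strictly_between; lia.
  + apply: (compatible_on_extend cover) => // [x|x y]; rewrite !inE => /or4P[] /eqP ->.
    1-4: lia.
    1-4: move=> /or4P[] /eqP ->; rewrite ?e1 ?e2 ?e3 ?e4 ?e5 ?e6 ?e7 ?e8;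
      rewrite /cross /strictly_between; lia.
  + apply: (compatible_on_extend cover) => // [x|x y]; rewrite !inE => /or4P[] /eqP ->.
    1-4: lia.
    1-4: by move=> /or4P[] /eqP ->; rewrite ?e5 ?e6 ?e7 ?e8 /cross /strictly_between; lia.
Qed.

(** Forced from the outside in. The long edge of [f] hides the interior from the ends of the short
    edge, so only the ends of the long edge are left for them, and non-crossing decides which goes
    where. The edges of [f] do not enclose the interval; hence the assumption that [h] preserves
    it. *)
Lemma chain_sole_left n f g a b h : chain f g a b -> b <= n ->
  ncm n h -> compatible n f h -> edge_disjoint n f h -> preserves h a b ->
  forall x, a <= x < b -> h x = g x.
Proof.
move=> ch bn [ph hh] cfh dfh; elim: ch bn => {a b} [a|a b ch IH e1 e2 e3 e4 e5 e6 e7 e8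
  |a b ch IH e1 e2 e3 e4 e5 e6 e7 e8] bn kh; first by move=> x; lia.
- have ab := on_le (chain_isolated_on ch).
  have [n1 i1 z1] := ph a.+1 ltac:(lia); have [n2 i2 z2] := ph a ltac:(lia).
  have d1 := dfh a.+1 ltac:(lia); have d2 := dfh a ltac:(lia).
  have k1 := kh a.+1 ltac:(lia); have k2 := kh a ltac:(lia).
  have c1 := fenced_chord cfh (a := a.+2) ltac:(lia) ltac:(lia) (x := h a).
  have c2 := fenced_chord cfh (a := a.+2) ltac:(lia) ltac:(lia) (x := h a.+1).
  have nx := hh a a.+1 ltac:(lia) ltac:(lia).
  rewrite /cross /strictly_between in nx.
  have nn : h a <> h a.+1 by move=> e; rewrite e i1 in i2; lia.
  have E1 : h a = b by lia.
  have E2 : h a.+1 = a.+2 by lia.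
  rewrite E1 in i2; rewrite E2 in i1; clear nx c1 c2 nn.
  have kin : preserves h a.+3 b.
    move=> x hx; have kx := kh x ltac:(lia); have [_ ix _] := ph x ltac:(lia).
    have o : h x \notin [:: a; a.+1; a.+2; b].
      by apply/negP; rewrite !inE => /or4P[] /eqP e; rewrite e ?E1 ?E2 ?i1 ?i2 in ix; lia.
    by rewrite !inE in o; lia.
  move=> x hx; case: (boolP (a.+3 <= x < b)) => [hin|hout].
    by apply: IH => //; lia.
  by have [->|[->|[->|->]]] : x = a \/ x = a.+1 \/ x = a.+2 \/ x = b; lia.
have ab := on_le (chain_isolated_on ch).
have [n1 i1 z1] := ph b.+1 ltac:(lia); have [n2 i2 z2] := ph b.+2 ltac:(lia).
have d1 := dfh b.+1 ltac:(lia); have d2 := dfh b.+2 ltac:(lia).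
have k1 := kh b.+1 ltac:(lia); have k2 := kh b.+2 ltac:(lia).
have c1 := fenced_chord cfh (a := a) ltac:(lia) ltac:(lia) (x := h b.+1).
have c2 := fenced_chord cfh (a := a) ltac:(lia) ltac:(lia) (x := h b.+2).
have nx := hh b.+1 b.+2 ltac:(lia) ltac:(lia).
rewrite /cross /strictly_between in nx.
have nn : h b.+1 <> h b.+2 by move=> e; rewrite e i2 in i1; lia.
have E1 : h b.+1 = b by lia.
have E2 : h b.+2 = a by lia.
rewrite E1 in i1; rewrite E2 in i2; clear nx c1 c2 nn.
have kin : preserves h a.+1 b.
  move=> x hx; have kx := kh x ltac:(lia); have [_ ix _] := ph x ltac:(lia).
  have o : h x \notin [:: a; b; b.+1; b.+2].
    by apply/negP; rewrite !inE => /or4P[] /eqP e; rewrite e ?E1 ?E2 ?i1 ?i2 in ix; lia.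
  by rewrite !inE in o; lia.
move=> x hx; case: (boolP (a.+1 <= x < b)) => [hin|hout].
  by apply: IH => //; lia.
by have [->|[->|[->|->]]] : x = a \/ x = b \/ x = b.+1 \/ x = b.+2; lia.
Qed.

(** Forced from the inside out. By induction [h] agrees with [f] on the inner interval, which is
    therefore closed under [h]; the outer edge of [g] is a fence. So the ends of the short edge of
    [g] go to the ends of the outer one. *)
Lemma chain_sole_right n f g a b h : chain f g a b -> b <= n ->
  ncm n h -> compatible n g h -> edge_disjoint n g h ->
  forall x, a <= x < b -> h x = f x.
Proof.
move=> ch bn [ph hh] cgh dgh; elim: ch bn => {a b} [a|a b ch IH e1 e2 e3 e4 e5 e6 e7 e8
  |a b ch IH e1 e2 e3 e4 e5 e6 e7 e8] bn; first by move=> x; lia.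
- have [ab pf _ _ _ _ _] := chain_isolated_on ch.
  have [n1 i1 z1] := ph a.+1 ltac:(lia); have [n2 i2 z2] := ph a.+2 ltac:(lia).
  have d1 := dgh a.+1 ltac:(lia); have d2 := dgh a.+2 ltac:(lia).
  have c1 := fenced_chord cgh (a := a) ltac:(lia) ltac:(lia) (x := a.+1).
  have c2 := fenced_chord cgh (a := a) ltac:(lia) ltac:(lia) (x := a.+2).
  have nx := hh a.+1 a.+2 ltac:(lia) ltac:(lia).
  rewrite /cross /strictly_between in nx.
  have nn : h a.+1 <> h a.+2 by move=> e; rewrite e i2 in i1; lia.
  have IH' : forall x, a.+3 <= x < b -> h x = f x by apply: IH; lia.
  have o x : x < n -> ~~ (a.+3 <= x < b) -> ~~ (a.+3 <= h x < b).
    move=> xn; apply: contra => hx; have [_ ix _] := ph x xn.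
    by rewrite -ix IH' //; case: (pf _ hx).
  have o1 := o a.+1 ltac:(lia) ltac:(lia); have o2 := o a.+2 ltac:(lia) ltac:(lia).
  have E1 : h a.+1 = a by lia.
  have E2 : h a.+2 = b by lia.
  rewrite E1 in i1; rewrite E2 in i2; clear nx c1 c2 nn.
  move=> x hx; case: (boolP (a.+3 <= x < b)) => [hin|hout]; first exact: IH'.
  by have [->|[->|[->|->]]] : x = a \/ x = a.+1 \/ x = a.+2 \/ x = b; lia.
have [ab pf _ _ _ _ _] := chain_isolated_on ch.
have [n1 i1 z1] := ph b ltac:(lia); have [n2 i2 z2] := ph b.+1 ltac:(lia).
have d1 := dgh b ltac:(lia); have d2 := dgh b.+1 ltac:(lia).
have c1 := fenced_chord cgh (a := a) ltac:(lia) ltac:(lia) (x := b).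
have c2 := fenced_chord cgh (a := a) ltac:(lia) ltac:(lia) (x := b.+1).
have nx := hh b b.+1 ltac:(lia) ltac:(lia).
rewrite /cross /strictly_between in nx.
have nn : h b <> h b.+1 by move=> e; rewrite e i2 in i1; lia.
have IH' : forall x, a.+1 <= x < b -> h x = f x by apply: IH; lia.
have o x : x < n -> ~~ (a.+1 <= x < b) -> ~~ (a.+1 <= h x < b).
  move=> xn; apply: contra => hx; have [_ ix _] := ph x xn.
  by rewrite -ix IH' //; case: (pf _ hx).
have o1 := o b ltac:(lia) ltac:(lia); have o2 := o b.+1 ltac:(lia) ltac:(lia).
have E1 : h b = a by lia.
have E2 : h b.+1 = b.+2 by lia.
rewrite E1 in i1; rewrite E2 in i2; clear nx c1 c2 nn.
move=> x hx; case: (boolP (a.+1 <= x < b)) => [hin|hout]; first exact: IH'.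
by have [->|[->|[->|->]]] : x = a \/ x = b \/ x = b.+1 \/ x = b.+2; lia.
Qed.

Lemma chain_isolated_pair n f g : chain f g 0 n -> isolated_pair n f g.
Proof.
move=> ch; have [_ pf pg d cf c cg] := chain_isolated_on ch.
split.
- by split=> [x hx|x y hx hy]; [have [] := pf x ltac:(lia) | apply: cf; lia].
- by split=> [x hx|x y hx hy]; [have [] := pg x ltac:(lia) | apply: cg; lia].
- by move=> x y hx hy; apply: c; lia.
- by move=> x hx; apply: d; lia.
- move=> h nh chh dh x hx; apply: (chain_sole_left ch (leqnn n)) => //.
  by move=> y hy; have [] := nh.1 y ltac:(lia); lia.
- by move=> h nh chh dh x hx; apply: (chain_sole_right ch (leqnn n)).
Qed.

(** * Consecutive quadrilaterals and the whole circle *)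

Lemma chain_first_quad f g a b : chain f g a b -> a < b ->
  exists x, [/\ (a <= x) && (x.+3 < b), f x = x.+1, g x = x.+3, g x.+1 = x.+2 & f x.+2 = x.+3].
Proof.
elim=> {a b} [a|a b ch IH e1 e2 e3 e4 e5 e6 e7 e8|a b ch IH e1 e2 e3 e4 e5 e6 e7 e8]; first lia.
- move=> _; have ab := on_le (chain_isolated_on ch).
  (* If the inner interval is empty, this is the innermost step and its four points are
     consecutive. *)
  have [ab'|ab'] := ltnP a.+3 b; last by exists a; split; lia.
  by have [x [h1 h2 h3 h4 h5]] := IH ab'; exists x; split; lia.
- move=> _; have ab := on_le (chain_isolated_on ch).
  have [ab'|ab'] := ltnP a.+1 b; last first.
    have eb : b = a.+1 by lia.
    by rewrite eb in e1 e3 e5 e7 *; exists a; split => //; lia.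
  by have [x [h1 h2 h3 h4 h5]] := IH ab'; exists x; split; lia.
Qed.

(* A quadrilateral on four consecutive points becomes the last step of a chain
   for the swapped pair, once its last vertex is rotated to 0. *)
Lemma quad_chain n f g x : isolated_pair n f g -> x.+3 < n ->
  f x = x.+1 -> g x = x.+3 -> g x.+1 = x.+2 -> f x.+2 = x.+3 ->
  exists2 r, r <= n & forall f' g', rotated n r f f' -> rotated n r g g' ->
    chain g' f' 0 n.
Proof.
move=> U hx fx gx gx1 fx2; exists x.+3; first lia.
move=> f' g' Rf Rg.
have hr : x.+3 <= n by lia.
have U' := isolated_pair_rotated hr Rf Rg U.
have [m en] : {m | n = m.+4} by exists (n - 4); lia.
have val (h h' : nat -> nat) (R : rotated n x.+3 h h') y z :
    y < n -> z < n -> h (tau n x.+3 y) = tau n x.+3 z -> h' y = z.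
  move=> hy hz e; have [h1 _ h2] := R y hy.
  by apply/eqP; rewrite -(tau_inj hr) // -h2 e.
have t0 : tau n x.+3 0 = x.+3 by rewrite /tau hx.
have t1 : tau n x.+3 m.+1 = x by rewrite /tau; case: ifP; lia.
have t2 : tau n x.+3 m.+2 = x.+1 by rewrite /tau; case: ifP; lia.
have t3 : tau n x.+3 m.+3 = x.+2 by rewrite /tau; case: ifP; lia.
have [[nf _] [ng _]] := (pair_ncml U, pair_ncmr U).
have [_ ffx _] := nf x ltac:(lia); rewrite fx in ffx.
have [_ ffx2 _] := nf x.+2 ltac:(lia); rewrite fx2 in ffx2.
have [_ ggx _] := ng x ltac:(lia); rewrite gx in ggx.
have [_ ggx1 _] := ng x.+1 ltac:(lia); rewrite gx1 in ggx1.
have a1 : g' 0 = m.+1 by apply: (val g) => //; rewrite ?t0 ?t1; lia.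
have a2 : g' m.+1 = 0 by apply: (val g) => //; rewrite ?t0 ?t1; lia.
have a3 : g' m.+2 = m.+3 by apply: (val g) => //; rewrite ?t2 ?t3; lia.
have a4 : g' m.+3 = m.+2 by apply: (val g) => //; rewrite ?t2 ?t3; lia.
have a5 : f' 0 = m.+3 by apply: (val f) => //; rewrite ?t0 ?t3; lia.
have a6 : f' m.+3 = 0 by apply: (val f) => //; rewrite ?t0 ?t3; lia.
have a7 : f' m.+1 = m.+2 by apply: (val f) => //; rewrite ?t1 ?t2; lia.
have a8 : f' m.+2 = m.+1 by apply: (val f) => //; rewrite ?t1 ?t2; lia.
rewrite en; apply: ChainR => //.
(* The inner chain lies below the edge of [g'] from 0 to [m.+1]; the points there are stable under
   [f'], which matches the other four among themselves. *)
apply: (isolated_pair_chain (isolated_pairC U')) => //; first lia.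
move=> y hy; have [h1 h2 h3] := (pair_ncml U').1 y ltac:(lia).
have o : f' y \notin [:: 0; m.+1; m.+2; m.+3].
  by apply/negP; rewrite !inE => /or4P[] /eqP e; rewrite e ?a5 ?a6 ?a7 ?a8 in h2; lia.
by rewrite !inE in o; lia.
Qed.

Lemma rotated0 n f : pairing n f -> rotated n 0 f f.
Proof.
move=> pf x hx; have [h1 _ _] := pf x hx; rewrite /tau !addn0 hx h1.
by split.
Qed.

Lemma rotated_trans n r s f f' f'' : r <= n -> s <= n -> rotated n r f f' ->
  rotated n s f' f'' -> rotated n (if r + s <= n then r + s else r + s - n) f f''.
Proof.
move=> hr hs R S x hx.
have tt y : y < n -> tau n (if r + s <= n then r + s else r + s - n) y = tau n r (tau n s y).
  rewrite /tau => hy; case: (leqP (r + s) n) => h1; case: (ltnP (y + s) n) => h2;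
    do 2 (case: ltnP => ?); lia.
have [h1 _ h2] := S x hx; have [_ h3 _] := R x hx.
have [_ _ h4] := R _ (tau_lt hs hx).
by split=> //; rewrite !tt // h4 h2.
Qed.

Definition quad_at n (f g : nat -> nat) x :=
  [/\ x.+3 < n, f x = x.+1, g x = x.+3, g x.+1 = x.+2 & f x.+2 = x.+3].

(** Since [g 0] lies beyond [f 0], [same_side] shows that [g] matches neither end of this edge
    inside it. The inside is thus a chain, non-empty because [1 < f 0], and its innermost step is
    the quadrilateral. *)
Lemma short_chord_quad n f g : isolated_pair n f g -> 0 < n -> 1 < f 0 ->
  f 0 < g 0 -> exists x, quad_at n f g x.
Proof.
move=> U n0 f0 fg.
have [[pf cf] [pg cg] cfg dfg _ _] := U.
have [r er] : {r | f 0 = r.+1} by exists (f 0).-1; lia.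
have [hf ff _] := pf 0 n0; have [hg gg _] := pg 0 n0.
have fen := fenced_chord cfg (a := 0) ltac:(lia) hf.
have [_ sgr] := same_side (conj pf cf) (conj pg cg) cfg (a := 0) (b := f 0) ltac:(lia) hf erefl.
have ch : chain f g 1 r.+1.
  apply: (isolated_pair_chain U) => //; try lia.
  move=> x hx; have := fen x ltac:(lia); have [_ gx _] := pg x ltac:(lia).
  case: (eqVneq (g x) 0) => [e|n1]; first by rewrite e in gx; lia.
  case: (eqVneq (g x) (f 0)) => [e|n2]; first by rewrite e in gx; lia.
  lia.
have [|x [h1 h2 h3 h4 h5]] := chain_first_quad ch; first lia.
by exists x; split=> //; lia.
Qed.

(* The union of f and g is the convex hull: with at least eight points, two sides
   of f can be flipped. *)
Lemma hull_quad n f g : isolated_pair n f g -> 0 < n -> 4 %| n -> f 0 = 1 ->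
  (forall x, x.+1 < n -> f x = x.+1 \/ g x = x.+1) -> quad_at n f g 0.
Proof.
move=> U n0 /dvdnP[m en] f0 hull.
have [[pf cf] [pg cg] cfg dfg _ _] := U.
have fI x : x < n -> f (f x) = x by case/pf.
have gI x : x < n -> g (g x) = x by case/pg.
have f1 : f 1 = 0 by rewrite -f0 fI.
have next_g x : x.+2 < n -> f x = x.+1 -> g x.+1 = x.+2 /\ g x.+2 = x.+1.
  move=> hx e; have [e'|e'] := hull x.+1 hx; last by rewrite -{2}e' gI //; lia.
  by have := fI x ltac:(lia); rewrite e e'; lia.
have next_f x : x.+2 < n -> g x = x.+1 -> f x.+1 = x.+2 /\ f x.+2 = x.+1.
  move=> hx e; have [e'|e'] := hull x.+1 hx; first by rewrite -{2}e' fI //; lia.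
  by have := gI x ltac:(lia); rewrite e e'; lia.
have [g1 g2] := next_g 0 ltac:(lia) f0; have [f2 f3] := next_f 1 ltac:(lia) g1.
have [g0lt gg0 g0n] := pg 0 n0; have d0 := dfg 0 n0.
have g02 : g 0 <> 2 by move=> e; rewrite e in gg0; lia.
case: (eqVneq n 4) => [n4|n4]; first by split=> //; lia.
exfalso.
have [g3 g4] := next_g 2 ltac:(lia) f2; have [f4 f5] := next_f 3 ltac:(lia) g3.
have [g5 g6] := next_g 4 ltac:(lia) f4.
(* In a hexagon [g] would contain this chord. Here there are at least eight points, and [g] joins 5
   to 6. *)
have g05 : g 0 <> 5 by move=> e; rewrite e in gg0; lia.
have small (h : nat -> nat) a b :
    fenced h a b <-> forall x, x \in iota a.+1 (b - a.+1) -> a <= h x <= b.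
  by split=> H x hx; apply: H; move: hx; rewrite mem_iota; lia.
have [h1 h2] : ncm n (flip f 0 1 4 5) /\ compatible n (flip f 0 1 4 5) g.
  apply: flip_nest => //; try lia; apply/small => x; rewrite !inE.
  - by case/or4P => /eqP ->; lia.
  - by case/orP => /eqP ->; lia.
  - by case/orP => /eqP ->; lia.
apply: (isolated_pair_no_other (x := 0) U h1 h2) => [x hx||]; rewrite /flip ?eqxx; try lia.
do 4 (case: eqP => [->|?]; first by lia).
exact: dfg.
Qed.

Lemma rot_fun_side n r f : r < n -> 1 < n -> pairing n f -> rot_fun n r f 0 = 1 ->
  f r = tau n r 1.
Proof.
move=> hr hn pf e; have [_ _] := rot_funP (ltnW hr) pf (ltnW hn).
by rewrite e => <-; congr f; rewrite /tau hr.
Qed.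

(** If some side of the hull is in neither matching, its first point is rotated to 0, and the
    shorter of the two edges at 0 has a non-empty inside. Otherwise every side belongs to [f] or [g]
    and [hull_quad] applies. *)
Lemma exists_quad n f g : isolated_pair n f g -> 0 < n -> 4 %| n ->
  exists r f' g' x, [/\ r <= n, rotated n r f f', rotated n r g g' &
    quad_at n f' g' x \/ quad_at n g' f' x].
Proof.
move=> U n0 dn; have [[pf cf] [pg cg] cfg dfg _ _] := U.
have n1 : 1 < n by case/dvdnP: dn => m; lia.
case: (boolP [exists r : 'I_n, (rot_fun n r f 0 != 1) && (rot_fun n r g 0 != 1)]).
  case/existsP=> r /andP[/eqP f1 /eqP g1].
  have hr : r <= n by rewrite ltnW.
  have [Rf Rg] := (rot_funP hr pf, rot_funP hr pg).
  have U' := isolated_pair_rotated hr Rf Rg U.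
  have [[pf' _] [pg' _] _ d' _ _] := U'.
  have [_ _ f0] := pf' 0 n0; have [_ _ g0] := pg' 0 n0; have d0 := d' 0 n0.
  have [lt|le] := ltnP (rot_fun n r f 0) (rot_fun n r g 0).
    have [x q] := short_chord_quad U' n0 ltac:(lia) lt.
    by exists r, (rot_fun n r f), (rot_fun n r g), x; split=> //; left.
  have [x q] := short_chord_quad (isolated_pairC U') n0 ltac:(lia) ltac:(lia).
  by exists r, (rot_fun n r f), (rot_fun n r g), x; split=> //; right.
rewrite negb_exists => /forallP H.
have hull x : x.+1 < n -> f x = x.+1 \/ g x = x.+1.
  move=> hx; have := H (Ordinal (ltnW hx)); rewrite negb_and !negbK /=.
  have t1 : tau n x 1 = x.+1 by rewrite /tau add1n hx.
  by case/orP => /eqP e; [left | right]; rewrite -t1; apply: rot_fun_side => //; lia.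
have [e|e] := hull 0 n1.
  exists 0, f, g, 0; split=> //; try exact: rotated0.
  by left; apply: hull_quad.
exists 0, f, g, 0; split=> //; try exact: rotated0.
right; apply: (hull_quad (isolated_pairC U)) => // x /hull; tauto.
Qed.

Lemma exists_rotated_chain n f g : isolated_pair n f g -> 0 < n -> 4 %| n ->
  exists r f' g', [/\ r <= n, rotated n r f f', rotated n r g g' & chain f' g' 0 n].
Proof.
move=> U n0 dn.
(* [quad_chain] exchanges the two matchings, so a quadrilateral of the exchanged pair gives the
   chain in the wanted order. *)
have swap r h h' y : r <= n -> rotated n r f h -> rotated n r g h' ->
    quad_at n h' h y ->
    exists r f' g', [/\ r <= n, rotated n r f f', rotated n r g g' & chain f' g' 0 n].
  move=> hr Rh Rh' [h1 h2 h3 h4 h5].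
  have U' := isolated_pair_rotated hr Rh Rh' U.
  have [[ph _] [ph' _] _ _ _ _] := U'.
  have [s hs /(_ _ _ (rot_funP hs ph') (rot_funP hs ph)) ch] :=
    quad_chain (isolated_pairC U') h1 h2 h3 h4 h5.
  have Rf := rotated_trans hr hs Rh (rot_funP hs ph).
  have Rg := rotated_trans hr hs Rh' (rot_funP hs ph').
  exists (if r + s <= n then r + s else r + s - n), (rot_fun n s h), (rot_fun n s h').
  by split=> //; case: ifP; lia.
have [r [f' [g' [x [hr Rf Rg [|]]]]]] := exists_quad U n0 dn;
  last exact: (swap _ _ _ x hr Rf Rg).
move=> [h1 h2 h3 h4 h5]; have U' := isolated_pair_rotated hr Rf Rg U.
have [[pf _] [pg _] _ _ _ _] := U'.
have [s hs /(_ _ _ (rot_funP hs pf) (rot_funP hs pg)) ch] := quad_chain U' h1 h2 h3 h4 h5.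
(* Here the chain comes out for the exchanged pair. Its innermost step is a quadrilateral of that
   pair, and a second rotation restores the order. *)
have [y [q1 q2 q3 q4 q5]] := chain_first_quad ch n0.
have hrs : (if r + s <= n then r + s else r + s - n) <= n by case: ifP; lia.
apply: (swap _ _ _ y hrs (rotated_trans hr hs Rf (rot_funP hs pf))
  (rotated_trans hr hs Rg (rot_funP hs pg))).
by split=> //; lia.
Qed.

(** * The dual tree as a closed walk *)
(* The vertices D_i and B_i (i > 0) of the tree are coded by 2i and 2i+1; B_0
   takes the place of a vertex D_0 and is coded by 0, so that 1 codes nothing. *)
Definition is_code l c := (c <= l.*2.+1) && (c != 1).

Definition code_adj u v :=
  ~~ odd u && ((v == u.+1) || (v == u.+2)) || ~~ odd v && ((u == v.+1) || (u == v.+2)).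

(** Intended reading: [a x] codes the region of the arc just before the point [x]. Passing a point
    crosses one chord, and two arcs lie in one region iff the points between them are matched among
    themselves; in particular a stable range from 0 to [n] closes the walk. *)
Definition tour n l (f a : nat -> nat) :=
  [/\ forall x, x <= n -> is_code l (a x),
      forall x, x < n -> code_adj (a x) (a x.+1) &
      forall i j, i <= j <= n -> a i = a j <-> preserves f i j].

Lemma chord_preserves n f x : ncm n f -> x < n -> x < f x ->
  preserves f x.+1 (f x) /\ preserves f x (f x).+1.
Proof.
move=> [pf cf] hx xf; have [h1 h2 _] := pf x hx.
have fen := fenced_chord cf xf h1.
have pre : preserves f x.+1 (f x).
  move=> y hy; have := fen y ltac:(lia); have [_ e _] := pf y ltac:(lia).
  case: (eqVneq (f y) x) => [ey|?]; first by rewrite ey in e; lia.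
  case: (eqVneq (f y) (f x)) => [ey|?]; first by rewrite ey in e; lia.
  lia.
split=> // y hy; have := pre y.
by case: (eqVneq y x) => [->|?]; [lia|case: (eqVneq y (f x)) => [->|?]; lia].
Qed.

(** Each directed edge of the tree is walked at most once: if the ranges from [p] and from [p.+1]
    were both stable, [f p] would lie in the second one while its partner [p] does not. *)
Lemma tour_inj n l f a p q : tour n l f a -> pairing n f -> p < n -> q < n ->
  a p = a q -> a p.+1 = a q.+1 -> p = q.
Proof.
move=> [_ _ tp] pf; wlog lt : p q / p < q.
  move=> W hp hq e1 e2; case: (ltngtP p q) => // h; first exact: W.
  by apply/esym; apply: W.
move=> hp hq /(tp p q ltac:(lia)) k1 /(tp p.+1 q.+1 ltac:(lia)) k2.
have [_ e ne] := pf p hp; have h1 := k1 p ltac:(lia).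
by have := k2 (f p) ltac:(lia); lia.
Qed.

(** The step at [f p] walks the tree edge of the step at [p] backwards. Together with [tour_inj]
    this lets [f p] be read off from the walk. *)
Lemma tour_mate n l f a p : tour n l f a -> ncm n f -> p < n ->
  a (f p) = a p.+1 /\ a (f p).+1 = a p.
Proof.
move=> [_ _ tp] nf hp; have [h1 e ne] := nf.1 p hp.
case: (ltngtP p (f p)) => [lt|gt|]; last lia.
  have [c1 c2] := chord_preserves nf hp lt.
  by split; [rewrite (tp p.+1 (f p) _).2 | rewrite (tp p (f p).+1 _).2] => //; lia.
have gt' : f p < f (f p) by rewrite e.
have [] := chord_preserves nf h1 gt'; rewrite e => c1 c2.
by split; [rewrite (tp (f p) p.+1 _).2 | rewrite (tp (f p).+1 p _).2] => //; lia.
Qed.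

Lemma chain_ext f g g' a b : chain f g a b -> (forall x, a <= x < b -> g' x = g x) ->
  chain f g' a b.
Proof.
elim=> {a b} [a _|a b ch IH e1 e2 e3 e4 e5 e6 e7 e8 E|a b ch IH e1 e2 e3 e4 e5 e6 e7 e8 E].
- exact: ChainNil.
- have ab := on_le (chain_isolated_on ch).
  apply: ChainL => //; rewrite ?E //; try lia.
  by apply: IH => x hx; apply: E; lia.
- have ab := on_le (chain_isolated_on ch).
  apply: ChainR => //; rewrite ?E //; try lia.
  by apply: IH => x hx; apply: E; lia.
Qed.

(** Induction along the spine. From [D_m] the walk makes one excursion to the leaf [B_m] and one to
    the smaller codes, as no directed edge is repeated. Leaf first gives [ChainL], leaf last gives
    [ChainR]. *)
Lemma tour_chain n l f a m L R : tour n l f a -> ncm n f -> L <= R -> R <= n ->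
  a L = m.*2 -> a R = m.*2 -> (forall x, L <= x <= R -> a x <= m.*2.+1) ->
  (forall c, is_code m c -> exists2 x, L <= x <= R & a x = c) ->
  exists g, chain f g L R.
Proof.
move=> T nf; have [tc ta tp] := T; have inj := tour_inj T nf.1.
have mate := tour_mate T nf.
elim: m L R => [|m IH] L R LR Rn aL aR bnd onto.
  case: (eqVneq L R) => [->|ne]; first by exists id; apply: ChainNil.
  have := ta L ltac:(lia); have := bnd L.+1 ltac:(lia); have := tc L.+1 ltac:(lia).
  by rewrite aL /is_code /code_adj; case: (a L.+1) => [|[|]].
have adj x : L <= x < R -> code_adj (a x) (a x.+1) by move=> hx; apply: ta; lia.
(* Among the codes up to [c.+1], the only neighbours of [c] are [m.*2] and the leaf [c.+1]. *)
set c := m.*2.+2; have {}aL : a L = c by rewrite aL; lia.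
have {}aR : a R = c by rewrite aR; lia.
have ceven : odd c = false by rewrite /c; lia.
have fwd x : L <= x < R -> a x = c -> a x.+1 = m.*2 \/ a x.+1 = c.+1.
  by move=> hx e; have := adj x hx; have := bnd x.+1 ltac:(lia); rewrite e /code_adj; lia.
have bwd x : L <= x < R -> a x.+1 = c -> a x = m.*2 \/ a x = c.+1.
  by move=> hx e; have := adj x hx; have := bnd x ltac:(lia); rewrite e /code_adj; lia.
have leaf_out x : L <= x < R -> a x = c.+1 -> a x.+1 = c.
  by move=> hx e; have := adj x hx; rewrite e /code_adj; lia.
have leaf_in x : L <= x < R -> a x.+1 = c.+1 -> a x = c.
  by move=> hx e; have := adj x hx; rewrite e /code_adj; lia.
have [d hd ad] : exists2 d, L <= d <= R & a d = m.*2.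
  by apply: onto; rewrite /is_code; lia.
have dL : d <> L by move=> e; rewrite e aL in ad; lia.
have dR : d <> R by move=> e; rewrite e aR in ad; lia.
(* A stretch that avoids [c] and [c.+1], and outside which only these two occur, still visits every
   smaller code; the induction hypothesis applies to it. *)
have sub L' R' : L <= L' -> L' <= R' -> R' <= R -> a L' = m.*2 -> a R' = m.*2 ->
    (forall x, L <= x <= R -> ~~ (L' <= x <= R') -> a x = c \/ a x = c.+1) ->
    (forall x, L' <= x <= R' -> a x <> c) -> (forall x, L' <= x <= R' -> a x <> c.+1) ->
    exists g, chain f g L' R'.
  move=> h1 h2 h3 e1 e2 hout n1 n2; apply: IH => //; first lia.
    by move=> x hx; have := bnd x ltac:(lia); have := n1 x hx; have := n2 x hx; lia.
  move=> u hu; have [x hx ex] := onto u ltac:(move: hu; rewrite /is_code; lia).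
  exists x => //; case: (boolP (L' <= x <= R')) => // /(hout x hx).
  by rewrite ex; move: hu; rewrite /is_code; lia.
have [aL1|aL1] := fwd L ltac:(lia) aL.
- have [b hb ab] : exists2 b, L <= b <= R & a b = c.+1.
    by apply: onto; rewrite /is_code; lia.
  have bL : b <> L by move=> e; rewrite e aL in ab; lia.
  have bR : b <> R by move=> e; rewrite e aR in ab; lia.
  have [b1 eb] : {b1 | b = b1.+1} by exists b.-1; lia.
  subst b; have ab1 := leaf_in b1 ltac:(lia) ab.
  have ab2 := leaf_out b1.+1 ltac:(lia) ab.
  have b1L : b1 <> L by move=> e; rewrite e aL1 in ab; lia.
  have [b0 eb] : {b0 | b1 = b0.+1} by exists b1.-1; lia.
  subst b1; have [ab0|ab0] := bwd b0 ltac:(lia) ab1; last first.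
    by have := inj b0 b0.+2 ltac:(lia) ltac:(lia); rewrite ab0 ab ab1 ab2; lia.
  (* Both directed edges out of [c] are used up, at [L] and at [b0.+1], so the walk stops here. *)
  have eR : R = b0.+3.
    case: (eqVneq R b0.+3) => // ne.
    have [e|e] := fwd b0.+3 ltac:(lia) ab2.
      by have := inj b0.+3 L ltac:(lia) ltac:(lia); rewrite ab2 e aL aL1; lia.
    by have := inj b0.+3 b0.+1 ltac:(lia) ltac:(lia); rewrite ab2 e ab1 ab; lia.
  subst R; have [fL1 fL2 _] := nf.1 L ltac:(lia).
  have fL : f L = b0.
    have [m1 m2] := mate L ltac:(lia).
    by apply: inj => //; rewrite ?m1 ?m2 ?aL ?aL1 ?ab0 ?ab1 //; lia.
  have [fb1 fb2 _] := nf.1 b0.+1 ltac:(lia).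
  have fb : f b0.+1 = b0.+2.
    have [m1 m2] := mate b0.+1 ltac:(lia).
    by apply: inj => //; rewrite ?m1 ?m2 ?ab2 ?ab ?ab1 //; lia.
  rewrite fL in fL2; rewrite fb in fb2.
  have b0L : b0 <> L by move=> e; rewrite e aL in ab0; lia.
  have [||||||||g ch] := sub L.+1 b0 => //; try lia.
  + move=> x hx hn; have [->|[->|[->|->]]] : x = L \/ x = b0.+1 \/ x = b0.+2 \/ x = b0.+3;
      [lia|by left..|by right|by left].
  + move=> x hx e; case: (eqVneq x L.+1) => [ex|nx]; first by rewrite ex aL1 in e; lia.
    have [y ey] : {y | x = y.+1} by exists x.-1; lia.
    subst x; have [e'|e'] := bwd y ltac:(lia) e.
      by have := inj y b0 ltac:(lia) ltac:(lia); rewrite e' e ab0 ab1; lia.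
    by have := inj y b0.+2 ltac:(lia) ltac:(lia); rewrite e' e ab ab2; lia.
  + move=> x hx e; have [y ey] : {y | x = y.+1} by exists x.-1; lia.
    subst x; have e' := leaf_in y ltac:(lia) e.
    by have := inj y b0.+1 ltac:(lia) ltac:(lia); rewrite e' e ab1 ab; lia.
  exists (fun x => if x == L then b0.+2 else if x == b0.+2 then L else
     if x == b0 then b0.+1 else if x == b0.+1 then b0 else g x).
  apply: ChainR => //; try by do ?case: eqP; lia.
  by apply: chain_ext ch _ => x hx; do ?case: eqP => //; lia.
(* The leaf comes first: the walk starts with [c], [c.+1], [c]. *)
have L1R : L.+1 <> R by move=> e; rewrite -e aL1 in aR; lia.
have aL2 := leaf_out L.+1 ltac:(lia) aL1.
have d1 : d <> L.+1 by move=> e; rewrite e aL1 in ad; lia.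
have d2 : d <> L.+2 by move=> e; rewrite e aL2 in ad; lia.
have [aL3|aL3] := fwd L.+2 ltac:(lia) aL2; last first.
  by have := inj L.+2 L ltac:(lia) ltac:(lia); rewrite aL aL1 aL2 aL3; lia.
have [S eS] : {S | R = S.+1} by exists R.-1; lia.
subst R; have [aS|aS] := bwd S ltac:(lia) aR; last first.
  by have := inj S L.+1 ltac:(lia) ltac:(lia); rewrite aS aR aL1 aL2; lia.
have [fL1 fL2 _] := nf.1 L ltac:(lia).
have fL : f L = L.+1.
  have [m1 m2] := mate L ltac:(lia).
  by apply: inj => //; rewrite ?m1 ?m2 ?aL ?aL1 ?aL2 //; lia.
have [fb1 fb2 _] := nf.1 L.+2 ltac:(lia).
have fb : f L.+2 = S.
  have [m1 m2] := mate L.+2 ltac:(lia).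
  by apply: inj => //; rewrite ?m1 ?m2 ?aL2 ?aL3 ?aS ?aR //; lia.
rewrite fL in fL2; rewrite fb in fb2.
have SL : S <> L.+2 by move=> e; rewrite e aL2 in aS; lia.
have [||||||||g ch] := sub L.+3 S => //; try lia.
+ move=> x hx hn; have [->|[->|[->|->]]] : x = L \/ x = L.+1 \/ x = L.+2 \/ x = S.+1;
    [lia|by left|by right|by left..].
+ move=> x hx e; case: (eqVneq x L.+3) => [ex|nx]; first by rewrite ex aL3 in e; lia.
  have [y ey] : {y | x = y.+1} by exists x.-1; lia.
  subst x; have [e'|e'] := bwd y ltac:(lia) e.
    by have := inj y S ltac:(lia) ltac:(lia); rewrite e' e aS aR; lia.
  by have := inj y L.+1 ltac:(lia) ltac:(lia); rewrite e' e aL1 aL2; lia.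
+ move=> x hx e; have [y ey] : {y | x = y.+1} by exists x.-1; lia.
  subst x; have e' := leaf_in y ltac:(lia) e.
  by have := inj y L ltac:(lia) ltac:(lia); rewrite e' e aL aL1; lia.
exists (fun x => if x == L then S else if x == S then L else
   if x == L.+1 then L.+2 else if x == L.+2 then L.+1 else g x).
apply: ChainL => //; try by do ?case: eqP; lia.
by apply: chain_ext ch _ => x hx; do ?case: eqP => //; lia.
Qed.

(** * Separating chords and tree distance *)

Definition separates (f : nat -> nat) i j p :=
  arc_inside p (f p) i != arc_inside p (f p) j.

(** The sum runs over points, so each chord is counted at both ends and adjacent regions have count
    2. *)
Definition sepcount n f i j := \sum_(0 <= p < n) separates f i j p.

Definition coded_db n l f := exists a : nat -> nat,
  [/\ forall x, x < n -> is_code l (a x),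
      forall c, is_code l c -> exists2 x, x < n & a x = c,
      forall i j, i < n -> j < n -> a i = a j <-> sepcount n f i j = 0 &
      forall i j, i < n -> j < n -> code_adj (a i) (a j) <-> sepcount n f i j = 2].

Lemma sepcount_rotated n r f f' i j : r <= n -> rotated n r f f' -> i < n -> j < n ->
  sepcount n f (tau n r i) (tau n r j) = sepcount n f' i j.
Proof.
move=> hr R hi hj; rewrite /sepcount !big_mkord.
pose t (x : 'I_n) := Ordinal (tau_lt hr (ltn_ord x)).
have tI : injective t.
  by move=> x y /(congr1 val)/eqP; rewrite /= tau_inj // => /eqP/val_inj.
rewrite (reindex_inj tI) /=; apply: eq_bigr => p _.
have [h1 _ h2] := R p (ltn_ord p); rewrite /separates h2 !arc_inside_tau //.
by case: ((p + r < n) != (f' p + r < n)); case: arc_inside; case: arc_inside.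
Qed.

Lemma coded_db_rotated n l r f f' : r <= n -> rotated n r f f' ->
  coded_db n l f' -> coded_db n l f.
Proof.
move=> hr R [a [h1 h2 h3 h4]]; have hr' : n - r <= n by lia.
have R' := rotatedC hr R; exists (fun x => a (tau n (n - r) x)); split.
- by move=> x hx; apply: h1; apply: tau_lt.
- move=> c /h2[x hx <-]; exists (tau n r x); first exact: tau_lt.
  by rewrite tauK.
- by move=> i j hi hj; rewrite h3 ?tau_lt // (sepcount_rotated hr' R').
- by move=> i j hi hj; rewrite h4 ?tau_lt // (sepcount_rotated hr' R').
Qed.

(* The arc preceding the point j; the points 0 and n are preceded by the same arc. *)
Definition arc_before n j := if j is j'.+1 then j' else n.-1.

(** The walk from one arc to the other crosses a chord once for every endpoint it passes, so the
    chord separates them iff exactly one endpoint is passed. *)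
Lemma separates_before n f i j p : pairing n f -> p < n -> i <= j -> j <= n ->
  separates f (arc_before n i) (arc_before n j) p =
  ((i <= p < j) != (i <= f p < j)).
Proof.
move=> pf hp hij hj; have [h1 _ _] := pf p hp.
have E x : x <= n -> arc_inside p (f p) (arc_before n x) = (minn p (f p) < x <= maxn p (f p)).
  by rewrite /arc_inside; case: x => [|x] /=; lia.
by rewrite /separates !E; lia.
Qed.

Lemma sepcount_eq0 n f i j : pairing n f -> i <= j -> j <= n ->
  sepcount n f (arc_before n i) (arc_before n j) = 0 <-> preserves f i j.
Proof.
move=> pf hij hj; rewrite /sepcount big_mkord; split=> [/eqP|k].
  rewrite sum_nat_eq0 => /forallP H x hx; have hxn : x < n by lia.
  by have := H (Ordinal hxn); rewrite /= separates_before //; lia.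
apply: big1 => p _; rewrite separates_before //.
have [h1 e _] := pf p (ltn_ord p); have := k p; have := k (f p); rewrite e; lia.
Qed.

Lemma sum_eq1 n x : x < n -> \sum_(0 <= p < n) (p == x : nat) = 1.
Proof.
move=> hx; rewrite big_mkord (bigD1 (Ordinal hx)) //= eqxx big1 // => p np.
by case: eqP => // e; case/eqP: np; apply: val_inj.
Qed.

Lemma sepcount_next n f x : pairing n f -> x < n ->
  sepcount n f (arc_before n x) (arc_before n x.+1) = 2.
Proof.
move=> pf hx; have [h1 e ne] := pf x hx.
transitivity (\sum_(0 <= p < n) ((p == x) + (p == f x))).
  rewrite /sepcount !big_mkord; apply: eq_bigr => p _.
  rewrite separates_before //; have [h2 e' ne'] := pf p (ltn_ord p).
  case: (eqVneq (p : nat) (f x)) => [ep|np]; first by rewrite ep e; lia.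
  have : f p <> x by move=> e2; rewrite -e2 e' eqxx in np.
  by case: (eqVneq (p : nat) x) => [->|]; lia.
by rewrite big_split /= !sum_eq1.
Qed.

Lemma coded_db_chain n l f : 0 < n -> ncm n f -> coded_db n l f ->
  exists r f' g', [/\ r <= n, rotated n r f f' & chain f' g' 0 n].
Proof.
move=> n0 nf [a [h1 h2 h3 h4]].
have [x0 hx0 ax0] : exists2 x, x < n & a x = l.*2 by apply: h2; rewrite /is_code; lia.
(* Rotating by [x0.+1] puts the arc [x0] just before the point 0, so the walk starts and ends at the
   code [l.*2]. *)
have R := rot_funP hx0 nf.1; set f' := rot_fun n x0.+1 f in R.
have nf' := rotated_ncm hx0 R nf.
pose A j := a (tau n x0.+1 (arc_before n j)).
have lt j : j <= n -> arc_before n j < n by case: j => /=; lia.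
have lt' j : j <= n -> tau n x0.+1 (arc_before n j) < n by move=> /lt; apply: tau_lt.
have A0 : A 0 = l.*2 by rewrite /A /tau /=; case: ltnP => ?; [lia|rewrite -[RHS]ax0; congr a; lia].
have An : A n = l.*2 by move: A0; rewrite /A; case: (n) n0.
have T : tour n l f' A.
  split=> [x hx|x hx|i j /andP[ij jn]].
  - by apply: h1; apply: lt'.
  - apply/h4; rewrite ?lt' //; try exact: ltnW.
    by rewrite (sepcount_rotated hx0 R) ?lt ?sepcount_next ?(ltnW hx) //; exact: nf'.1.
  - rewrite h3 ?lt' //; last exact: leq_trans jn.
    rewrite (sepcount_rotated hx0 R) ?lt //; last exact: leq_trans jn.
    exact: (sepcount_eq0 nf'.1).
have [|c hc|g ch] := tour_chain T nf' (leq0n n) (leqnn n) A0 An.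
- by move=> x /andP[_ hx]; have := h1 _ (lt' x hx); rewrite /is_code => /andP[].
- have [x hx ax] := h2 c hc.
  have hr' : n - x0.+1 <= n by lia.
  exists (tau n (n - x0.+1) x).+1; first by have := tau_lt hr' hx; lia.
  by rewrite /A /= tauKV.
by exists x0.+1, f', g.
Qed.

(** The distance in the tree: the difference along the spine plus one for each odd code, that is,
    each leaf [B_i] with [i > 0]. Without the separate case a leaf would be at distance 2 from
    itself. *)
Definition code_dist u v := if u == v then 0 else
  (u./2 - v./2) + (v./2 - u./2) + odd u + odd v.

Lemma code_dist_eq0 l u v : is_code l u -> is_code l v -> u = v <-> code_dist u v = 0.
Proof. by rewrite /is_code /code_dist; case: (eqVneq u v) => ? ? ?; split; lia. Qed.

Lemma code_dist_eq1 l u v : is_code l u -> is_code l v ->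
  code_adj u v <-> code_dist u v = 1.
Proof. by rewrite /is_code /code_dist /code_adj; case: (eqVneq u v) => ? ? ?; split; lia. Qed.

Lemma code_distC u v : code_dist u v = code_dist v u.
Proof. by rewrite /code_dist eq_sym; case: ifP => _ //; lia. Qed.

Lemma code_distxx u : code_dist u u = 0.
Proof. by rewrite /code_dist eqxx. Qed.

Lemma code_dist_trunk m u : is_code m u ->
  code_dist u m.*2.+2 = (code_dist u m.*2).+1.
Proof.
rewrite /is_code /code_dist => hu; have -> : (u == m.*2.+2) = false by lia.
by case: (eqVneq u m.*2) => [->|]; lia.
Qed.

Lemma code_dist_leaf m u : is_code m u ->
  code_dist u m.*2.+3 = (code_dist u m.*2).+2.
Proof.
rewrite /is_code /code_dist => hu; have -> : (u == m.*2.+3) = false by lia.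
by case: (eqVneq u m.*2) => [->|]; lia.
Qed.

Lemma code_dist_trunk_leaf m : code_dist m.*2.+2 m.*2.+3 = 1.
Proof. by rewrite /code_dist (_ : (_ == _) = false) /=; lia. Qed.

(** This is [arc_inside] for the arc preceding [x]; the shift gives the left end of an interval a
    position too. *)
Definition chord_in (f : nat -> nat) x p := minn p (f p) < x <= maxn p (f p).

Lemma sum_nat_recl3 s t (F : nat -> nat) : s.+3 <= t ->
  \sum_(s <= p < t.+1) F p = F s + F s.+1 + F s.+2 + \sum_(s.+3 <= p < t) F p + F t.
Proof.
move=> st; rewrite big_nat_recr /=; last lia.
rewrite (big_ltn (m := s)); last lia.
rewrite (big_ltn (m := s.+1)); last lia.
rewrite (big_ltn (m := s.+2)) /=; lia.
Qed.

Lemma sum_nat_recr3 s t (F : nat -> nat) : s.+1 <= t ->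
  \sum_(s <= p < t.+3) F p = F s + \sum_(s.+1 <= p < t) F p + F t + F t.+1 + F t.+2.
Proof.
move=> st; rewrite (big_nat_recr t.+2) /=; last lia.
rewrite (big_nat_recr t.+1) /=; last lia.
rewrite (big_nat_recr t) /=; last lia.
by rewrite (big_ltn (m := s)) /=; lia.
Qed.

(** A chain step adds [D_(m+1)], the region outside the long edge of [f], and the leaf cut off by
    the short edge. For the old chords every new position looks like the end [t] of the old
    interval; the long edge then adds one to the distance and the short edge one more for the
    leaf. *)
Lemma chain_distance f g s t : chain f g s t -> exists m A,
  [/\ t = s + m.*2.*2, A s = m.*2 /\ A t = m.*2,
      forall x, s <= x <= t -> is_code m (A x),
      forall c, is_code m c -> exists2 x, s <= x <= t & A x = c &
      forall x y, s <= x <= t -> s <= y <= t ->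
        \sum_(s <= p < t) (chord_in f x p != chord_in f y p) = (code_dist (A x) (A y)).*2].
Proof.
elim=> {s t} [s|s t ch [m [A [e [As At] Ac Ao Ad]]] e1 e2 e3 e4 _ _ _ _
             |s t ch [m [A [e [As At] Ac Ao Ad]]] e1 e2 e3 e4 _ _ _ _].
- exists 0, (fun=> 0); split=> //; first lia.
  + by move=> c; rewrite /is_code => hc; exists s; lia.
  + by move=> x y _ _; rewrite big_geq.
- have st := chain_isolated_on ch.
  (* Position [s.+1] lies below the short edge [(s, s.+1)]; the positions [s], [s.+2] and [t.+1] lie
     in the new outer region. *)
  pose B x := if s.+3 <= x <= t then A x else if x == s.+1 then m.*2.+3 else m.*2.+2.
  exists m.+1, B; split.
  + lia.
  + by rewrite /B; split; do ?case: ifP; lia.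
  + by move=> x hx; rewrite /B; case: ifP => [/Ac|_]; [|case: ifP]; rewrite /is_code; lia.
  + move=> c hc; case: (eqVneq c m.*2.+3) => [->|n1].
      by exists s.+1; rewrite /B ?eqxx; [lia|case: ifP; lia].
    case: (eqVneq c m.*2.+2) => [->|n2].
      by exists s; rewrite /B; [lia|do ?case: ifP; lia].
    have [x hx <-] := Ao c ltac:(move: hc; rewrite /is_code; lia).
    by exists x; [lia|rewrite /B hx].
  + move=> x y hx hy; rewrite (sum_nat_recl3 _ (on_le st)).
    (* New positions are moved to [t], from which no old chord separates them. *)
    pose pr z := if s.+3 <= z <= t then z else t.
    have hpr z : s.+3 <= pr z <= t by rewrite /pr; case: ifP; have := on_le st; lia.
    have cz z : s <= z <= t.+1 -> [/\ chord_in f z s = (z == s.+1), chord_in f z s.+1 = (z == s.+1),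
        chord_in f z s.+2 = (s.+3 <= z <= t) & chord_in f z t = (s.+3 <= z <= t)].
      by rewrite /chord_in e1 e2 e3 e4; have := on_le st; split; lia.
    have [xl1 xl2 xi1 xi2] := cz x hx; have [yl1 yl2 yi1 yi2] := cz y hy.
    rewrite (eq_big_nat _ _ (F2 := fun p => (chord_in f (pr x) p != chord_in f (pr y) p) : nat)).
      rewrite Ad // xl1 xl2 xi1 xi2 yl1 yl2 yi1 yi2 /B /pr.
      have lf z : s.+3 <= z <= t -> (z == s.+1) = false by lia.
      clear - Ac At lf; case: (boolP (s.+3 <= x <= t)) => ix;
        case: (boolP (s.+3 <= y <= t)) => iy /=.
      - by rewrite !lf //; lia.
      - rewrite (lf x) // At; have ux := Ac x ltac:(lia).
        by case: (y == _); rewrite /= ?code_dist_leaf ?code_dist_trunk //; lia.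
      - rewrite (lf y) // At 2!(code_distC _ (A y)); have uy := Ac y ltac:(lia).
        by case: (x == _); rewrite /= ?code_dist_leaf ?code_dist_trunk //; lia.
      - case: (x == _); case: (y == _); rewrite /= ?(code_distC m.*2.+3 m.*2.+2)
          ?code_distxx ?code_dist_trunk_leaf //.
    move=> p hp; have [h1 _ _] := on_pairingl st hp; congr (nat_of_bool (_ != _));
    rewrite /chord_in /pr; case: ifP; lia.
- have st := chain_isolated_on ch.
  (* The short edge is now [(t.+1, t.+2)], so the leaf sits at position [t.+2]. *)
  pose B x := if s.+1 <= x <= t then A x else if x == t.+2 then m.*2.+3 else m.*2.+2.
  exists m.+1, B; split.
  + lia.
  + by rewrite /B; split; do ?case: ifP; lia.
  + by move=> x hx; rewrite /B; case: ifP => [/Ac|_]; [|case: ifP]; rewrite /is_code; lia.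
  + move=> c hc; case: (eqVneq c m.*2.+3) => [->|n1].
      by exists t.+2; rewrite /B ?eqxx; [have := on_le st; lia|case: ifP; lia].
    case: (eqVneq c m.*2.+2) => [->|n2].
      by exists s; rewrite /B; [have := on_le st; lia|do ?case: ifP; have := on_le st; lia].
    have [x hx <-] := Ao c ltac:(move: hc; rewrite /is_code; lia).
    by exists x; [lia|rewrite /B hx].
  + move=> x y hx hy; rewrite (sum_nat_recr3 _ (on_le st)).
    pose pr z := if s.+1 <= z <= t then z else t.
    have hpr z : s.+1 <= pr z <= t by rewrite /pr; case: ifP; have := on_le st; lia.
    have cz z : s <= z <= t.+3 -> [/\ chord_in f z t.+1 = (z == t.+2), chord_in f z t.+2 = (z == t.+2),
        chord_in f z s = (s.+1 <= z <= t) & chord_in f z t = (s.+1 <= z <= t)].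
      by rewrite /chord_in e1 e2 e3 e4; have := on_le st; split; lia.
    have [xl1 xl2 xi1 xi2] := cz x hx; have [yl1 yl2 yi1 yi2] := cz y hy.
    rewrite (eq_big_nat _ _ (F2 := fun p => (chord_in f (pr x) p != chord_in f (pr y) p) : nat)).
      rewrite Ad // xl1 xl2 xi1 xi2 yl1 yl2 yi1 yi2 /B /pr.
      have lf z : s.+1 <= z <= t -> (z == t.+2) = false by lia.
      clear - Ac At lf; case: (boolP (s.+1 <= x <= t)) => ix;
        case: (boolP (s.+1 <= y <= t)) => iy /=.
      - by rewrite !lf //; lia.
      - rewrite (lf x) // At; have ux := Ac x ltac:(lia).
        by case: (y == _); rewrite /= ?code_dist_leaf ?code_dist_trunk //; lia.
      - rewrite (lf y) // At 2!(code_distC _ (A y)); have uy := Ac y ltac:(lia).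
        by case: (x == _); rewrite /= ?code_dist_leaf ?code_dist_trunk //; lia.
      - case: (x == _); case: (y == _); rewrite /= ?(code_distC m.*2.+3 m.*2.+2)
          ?code_distxx ?code_dist_trunk_leaf //.
    move=> p hp; have [h1 _ _] := on_pairingl st hp; congr (nat_of_bool (_ != _));
    rewrite /chord_in /pr; case: ifP; lia.
Qed.

Lemma chain_coded_db f g n : 0 < n -> chain f g 0 n ->
  exists2 l, n = l.*2.*2 & coded_db n l f.
Proof.
move=> n0 /chain_distance[m [A [e [A0 An] Ac Ao Ad]]]; exists m; first lia.
have S i j : i < n -> j < n -> sepcount n f i j = (code_dist (A i.+1) (A j.+1)).*2.
  move=> hi hj; rewrite -Ad; try lia; apply: eq_big_nat => p _.
  by rewrite /separates /arc_inside /chord_in; lia.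
(* The arc [x] precedes the point [x.+1]. Position 0 is not lost, having the same code as position
   [n]. *)
exists (fun x => A x.+1); split.
- by move=> x hx; apply: Ac; lia.
- move=> c /Ao[[|x] hx <-]; last by exists x.
  by exists n.-1; [lia|rewrite prednK // An A0].
- move=> i j hi hj; rewrite S //.
  by rewrite (code_dist_eq0 (l := m)); try lia; apply: Ac; lia.
- move=> i j hi hj; rewrite S //.
  by rewrite (code_dist_eq1 (l := m)); try lia; apply: Ac; lia.
Qed.

(** * The disjoint compatibility graph *)
Definition nat_fun n (F : {ffun 'I_n -> 'I_n}) x :=
  if insub x is Some i then val (F i) else x.

Lemma nat_funE n (F : {ffun 'I_n -> 'I_n}) (i : 'I_n) : nat_fun F i = F i.
Proof. by rewrite /nat_fun valK. Qed.

Lemma nat_fun_inj n (F G : {ffun 'I_n -> 'I_n}) :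
  (forall x, x < n -> nat_fun F x = nat_fun G x) -> F = G.
Proof.
by move=> e; apply/ffunP => i; apply: val_inj; have := e i (ltn_ord i); rewrite !nat_funE.
Qed.

Lemma is_matchingP n (F : {ffun 'I_n -> 'I_n}) : is_matching F <-> ncm n (nat_fun F).
Proof.
split=> [/andP[/forallP inv /forallP nc]|[inv nc]].
  split=> [x hx|x y hx hy].
    have /andP[/eqP e /eqP ne] := inv (Ordinal hx).
    rewrite (nat_funE F (Ordinal hx)); split; first exact: ltn_ord.
      by rewrite nat_funE e.
    by move=> h; apply: ne; apply: val_inj.
  rewrite (nat_funE F (Ordinal hx)) (nat_funE F (Ordinal hy)).
  exact: (forallP (nc (Ordinal hx)) (Ordinal hy)).
apply/andP; split; apply/forallP => i.
  have [_ e ne] := inv i (ltn_ord i); rewrite !nat_funE in e ne.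
  by apply/andP; split; apply/eqP; [exact: val_inj | move=> h; apply: ne; rewrite h].
by apply/forallP => j; have := nc i j (ltn_ord i) (ltn_ord j); rewrite !nat_funE.
Qed.

Lemma dcm_adjP k (M N : matching k) : dcm_adj M N <->
  compatible k.*2 (nat_fun (val M)) (nat_fun (val N)) /\
  edge_disjoint k.*2 (nat_fun (val M)) (nat_fun (val N)).
Proof.
split=> [/andP[/forallP d /forallP c]|[c d]].
  split=> [x y hx hy|x hx].
    rewrite (nat_funE _ (Ordinal hx)) (nat_funE _ (Ordinal hy)).
    exact: (forallP (c (Ordinal hx)) (Ordinal hy)).
  rewrite !(nat_funE _ (Ordinal hx)) => e.
  by have /eqP := d (Ordinal hx); apply; apply: val_inj.
apply/andP; split; apply/forallP => i.
  by apply/eqP => e; apply: (d i (ltn_ord i)); rewrite !nat_funE e.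
by apply/forallP => j; have := c i j (ltn_ord i) (ltn_ord j); rewrite !nat_funE.
Qed.

Lemma ncm_eq n f g : (forall x, x < n -> f x = g x) -> ncm n g -> ncm n f.
Proof.
move=> e [p c]; split=> [x hx|x y hx hy]; last by rewrite !e //; exact: c.
by have [h1 h2 h3] := p x hx; rewrite !e.
Qed.

Lemma exists_matching k h : ncm k.*2 h ->
  exists N : matching k, forall x, x < k.*2 -> nat_fun (val N) x = h x.
Proof.
move=> nh; pose F := [ffun i : 'I_(k.*2) => insubd i (h i)].
have e x : x < k.*2 -> nat_fun F x = h x.
  move=> hx; rewrite (nat_funE F (Ordinal hx)) ffunE val_insubd /=.
  by have [-> _ _] := nh.1 x hx.
have mF : is_matching F by apply/is_matchingP; apply: ncm_eq e nh.
by exists (exist _ F mF).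
Qed.

Lemma matching_ncm k (M : matching k) : ncm k.*2 (nat_fun (val M)).
Proof. by apply/is_matchingP; exact: valP M. Qed.

Lemma dcm_adj_neq k (M N : matching k) : 0 < k -> dcm_adj M N -> M != N.
Proof.
move=> k0 /dcm_adjP[_ d]; apply/eqP => e.
by apply: (d 0); rewrite ?e ?double_gt0.
Qed.

Lemma sole_neighbourP k (M N : matching k) :
  sole_neighbour k.*2 (nat_fun (val M)) (nat_fun (val N)) <->
  forall H, dcm_adj M H -> H = N.
Proof.
split=> [S H /dcm_adjP[c d]|S h nh c d].
  by apply: val_inj; apply: nat_fun_inj; apply: S; first exact: matching_ncm.
have [H eH] := exists_matching nh.
suff <- : H = N by move=> x hx; rewrite eH.
apply: S; apply/dcm_adjP; split=> [x y hx hy|x hx]; rewrite eH //; first exact: c.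
exact: d.
Qed.

(** For [0 < k] no matching is adjacent to itself, so a component with two vertices is a pair whose
    members are adjacent only to each other. *)
Lemma component_isolated_pair k (M : matching k) : 0 < k ->
  #|dcm_component M| = 2 <->
  exists g, isolated_pair k.*2 (nat_fun (val M)) g.
Proof.
move=> k0; split=> [c2|[g U]].
  have MC : M \in dcm_component M by rewrite inE connect0.
  have /cards1P[N eN] : #|dcm_component M :\ M| == 1.
    by have := cardsD1 M (dcm_component M); rewrite MC c2; lia.
  have CE H : H \in dcm_component M -> H != M -> H = N.
    by move=> hH nH; apply/set1P; rewrite -eN !inE nH; rewrite inE in hH.
  have adjM H : dcm_adj M H -> H = N.
    move=> a; apply: CE; first by rewrite inE connect1.
    by rewrite eq_sym dcm_adj_neq.
  have /setD1P[NM] : N \in dcm_component M :\ M by rewrite eN set11.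
  rewrite inE => cN.
  have aMN : dcm_adj M N.
    have [[|H p] /= h e] := connectP cN; first by rewrite e eqxx in NM.
    by case/andP: h => a _; rewrite -(adjM H a).
  have adjN H : dcm_adj N H -> H = M.
    move=> a; case: (eqVneq H M) => // nH.
    have e : H = N.
      by apply: CE => //; rewrite inE; apply: connect_trans cN _; rewrite connect1.
    by have := dcm_adj_neq k0 a; rewrite e eqxx.
  have [c d] := (dcm_adjP M N).1 aMN.
  exists (nat_fun (val N)); split=> //; try exact: matching_ncm.
    exact/sole_neighbourP.
  exact/sole_neighbourP.
have [N eN] := exists_matching (pair_ncmr U).
have aMN : dcm_adj M N.
  apply/dcm_adjP; split=> [x y hx hy|x hx]; rewrite eN //; first exact: (pair_compatible U).
  exact: (pair_disjoint U).
have adjM H : dcm_adj M H -> H = N.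
  apply/sole_neighbourP: H => h nh c d x hx; rewrite eN //.
  exact: (pair_solel U).
have adjN H : dcm_adj N H -> H = M.
  apply/sole_neighbourP: H => h nh c d x hx.
  apply: (pair_soler U) => // [y z hy hz|y hy]; rewrite -eN //; [exact: c|exact: d].
suff -> : dcm_component M = [set M; N] by rewrite cards2 (dcm_adj_neq k0 aMN).
apply/setP => H; rewrite !inE; apply/idP/orP => [/connectP[p]|[/eqP ->|/eqP ->]].
- suff W L : L = M \/ L = N -> path (@dcm_adj k) L p -> H = last L p -> H == M \/ H == N.
    by move=> hp e; apply: W hp e; left.
  elim: p L => [|K p IH] L /= hL; first by move=> _ ->; case: hL => ->; rewrite eqxx; auto.
  case/andP => a hp e; apply: IH hp e.
  by case: hL a => -> a; [right; exact: adjM | left; exact: adjN].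
- exact: connect0.
- exact: connect1.
Qed.

(** * Dual trees and codes *)

Definition vertex_code l (u : db_vertex l) : nat :=
  match u with inl b => if val b == 0 then 0 else (val b).*2.+1 | inr d => (val d).+1.*2 end.

Lemma vertex_code_inj l : injective (@vertex_code l).
Proof.
move=> [[b hb]|[d hd]] [[b' hb']|[d' hd']] /=.
- by move=> e; congr inl; apply: val_inj => /=; move: e; do 2 (case: eqP => ?); lia.
- by case: eqP => ? ?; exfalso; lia.
- by case: eqP => ? ?; exfalso; lia.
- by move=> e; congr inr; apply: val_inj => /=; lia.
Qed.

Lemma vertex_codeP l (u : db_vertex l) : is_code l (vertex_code u).
Proof. by case: u => [[b hb]|[d hd]]; rewrite /is_code /=; [case: eqP|]; lia. Qed.

Lemma vertex_code_onto l c : is_code l c -> exists u : db_vertex l, vertex_code u = c.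
Proof.
rewrite /is_code => hc; case: (boolP (odd c)) => oc.
  have h : c./2 < l.+1 by lia.
  by exists (inl (Ordinal h)); rewrite /=; case: eqP; lia.
case: (posnP c) => [->|c0]; first by exists (inl ord0).
have h : c./2.-1 < l by lia.
by exists (inr (Ordinal h)); rewrite /=; lia.
Qed.

Lemma db_adj_code l (u v : db_vertex l) :
  db_adj u v = code_adj (vertex_code u) (vertex_code v).
Proof.
case: u v => [[b hb]|[d hd]] [[b' hb']|[d' hd']]; rewrite /db_adj /code_adj /=.
- by case: (eqVneq b 0); case: (eqVneq b' 0); lia.
- by case: (eqVneq b 0); lia.
- by case: (eqVneq b' 0); lia.
- lia.
Qed.

Lemma arc_insideC a b x : arc_inside a b x = arc_inside b a x.
Proof. by rewrite /arc_inside minnC maxnC. Qed.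

(** [nsep] counts a chord at its smaller end only; the involution [F] carries this half of the sum
    onto the other half. *)
Lemma nsep_sepcount n (F : {ffun 'I_n -> 'I_n}) (i j : 'I_n) : pairing n (nat_fun F) ->
  (nsep F i j).*2 = sepcount n (nat_fun F) i j.
Proof.
move=> pF; have FK : involutive F.
  by move=> p; apply: val_inj; have [_] := pF p (ltn_ord p); rewrite !nat_funE.
have Fn p : F p != p.
  by apply/eqP => e; have [_ _] := pF p (ltn_ord p); rewrite nat_funE e.
pose s (p : 'I_n) := arc_inside p (F p) i != arc_inside p (F p) j.
have -> : sepcount n (nat_fun F) i j = \sum_(p < n) s p.
  rewrite /sepcount big_mkord; apply: eq_bigr => p _.
  by rewrite /separates nat_funE.
have -> : nsep F i j = \sum_(p < n | p < F p) s p.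
  rewrite /nsep cardsE -sum1_card big_mkcondr /=.
  by apply: eq_bigr => p _; rewrite /s; case: (_ != _).
rewrite [RHS](bigID (fun p : 'I_n => p < F p)) /= -addnn; congr addn.
rewrite (reindex_inj (inv_inj FK)) /=; apply: eq_big => [p|p _].
  rewrite FK; have : nat_of_ord (F p) <> p; last lia.
  by move/ord_inj => e; have := Fn p; rewrite e eqxx.
by rewrite /s FK; congr (nat_of_bool (_ != _)); exact: arc_insideC.
Qed.

Lemma sepcount_trans n f i j x : sepcount n f i j = 0 ->
  sepcount n f i x = sepcount n f j x.
Proof.
rewrite /sepcount !big_mkord => /eqP; rewrite sum_nat_eq0 => /forallP H.
apply: eq_bigr => p _; have := H p; rewrite /= /separates eqb0 negbK => /eqP ->.
by [].
Qed.

Lemma sepcountC n f i j : sepcount n f i j = sepcount n f j i.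
Proof. by apply: eq_bigr => p _; rewrite /separates eq_sym. Qed.

Lemma is_DB_coded k (M : matching k) :
  is_DB M <-> coded_db k.*2 k./2 (nat_fun (val M)).
Proof.
have [pM _] := matching_ncm M; have nsE := @nsep_sepcount _ (val M) _ _ pM.
have ns0 i j : nsep (val M) i j = 0 <-> sepcount k.*2 (nat_fun (val M)) i j = 0.
  by rewrite -nsE; lia.
have ns1 i j : nsep (val M) i j = 1 <-> sepcount k.*2 (nat_fun (val M)) i j = 2.
  by rewrite -nsE; lia.
split=> [[phi [onto [eqphi adjphi]]]|[a [h1 h2 h3 h4]]].
  pose a x := if insub x is Some i then vertex_code (phi i) else 0.
  have aE (i : 'I_(k.*2)) : a i = vertex_code (phi i) by rewrite /a valK.
  exists a; split.
  - by move=> x hx; rewrite (aE (Ordinal hx)) vertex_codeP.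
  - move=> c /vertex_code_onto[u <-]; have [i <-] := onto u.
    by exists i; [exact: ltn_ord | rewrite aE].
  - move=> i j hi hj; rewrite (aE (Ordinal hi)) (aE (Ordinal hj)).
    rewrite -(ns0 (Ordinal hi) (Ordinal hj)) -eqphi.
    by split=> [/vertex_code_inj|->].
  - move=> i j hi hj; rewrite (aE (Ordinal hi)) (aE (Ordinal hj)) -db_adj_code adjphi.
    (* Adjacency in [is_DB] is witnessed by some arcs of the two regions; the count does not depend
       on which arcs are chosen. *)
    rewrite -(ns1 (Ordinal hi) (Ordinal hj)); split=> [[i' [j' [/eqphi ei /eqphi ej]]]|e].
      move: ei ej; rewrite !ns0 !ns1 => ei ej <-.
      by rewrite -(sepcount_trans _ ei) sepcountC -(sepcount_trans _ ej) sepcountC.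
    by exists (Ordinal hi), (Ordinal hj).
have code_of (i : 'I_(k.*2)) : {u : db_vertex k./2 | vertex_code u == a i}.
  by apply: sigW; have [u <-] := vertex_code_onto (h1 i (ltn_ord i)); exists u.
pose phi i := sval (code_of i).
have phiE i : vertex_code (phi i) = a i by apply/eqP; exact: (svalP (code_of i)).
exists phi; split; last split.
- move=> u; have [x hx e] := h2 _ (vertex_codeP u).
  by exists (Ordinal hx); apply: vertex_code_inj; rewrite phiE.
- move=> i j; rewrite ns0 -h3 // -!phiE; split=> [->//|]; exact: vertex_code_inj.
- move=> u v; rewrite db_adj_code; split=> [a_uv|[i [j [<- <-]]]].
    have [x hx ex] := h2 _ (vertex_codeP u); have [y hy ey] := h2 _ (vertex_codeP v).
    exists (Ordinal hx), (Ordinal hy).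
    split; try by apply: vertex_code_inj; rewrite phiE.
    by apply/ns1/h4 => //; rewrite ex ey.
  by rewrite ns1 !phiE => e; apply/h4.
Qed.

Theorem mainTheorem15 (k : nat) (hk : (0 < k)%N) (heven : ~~ odd k)
    (M : matching k) :
  #|dcm_component M| = 2 <-> is_DB M.
Proof.
have n0 : 0 < k.*2 by lia.
rewrite component_isolated_pair // is_DB_coded; split=> [[g U]|db].
  have d4 : 4 %| k.*2 by lia.
  have [r [f' [g' [hr Rf Rg ch]]]] := exists_rotated_chain U n0 d4.
  have [l el db] := chain_coded_db n0 ch.
  have -> : k./2 = l by lia.
  exact: (coded_db_rotated hr Rf db).
have nM := matching_ncm M.
have [r [f' [g' [hr Rf ch]]]] := coded_db_chain n0 nM db.
have hr' : k.*2 - r <= k.*2 by lia.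
have U := chain_isolated_pair ch.
(* The partner of [M] is the second member of the chain, turned back. *)
exists (rot_fun k.*2 (k.*2 - r) g').
apply: (isolated_pair_rotated hr' (rotatedC hr Rf) _ U).
exact: (rot_funP hr' (pair_ncmr U).1).
Qed.
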